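(* Let $I\subset\mathbb{R}$ be an interval, let $f:I\to(0,\infty)$ be monotone, let $0\le\alpha\le 1$, and let $A,B$ be $n\times n$ complex Hermitian matrices with spectra in $I$. If $f$ is log-convex, then there exists an $n\times n$ unitary matrix $U$ such that $$ \lambda^\downarrow\big(f(\alpha A+(1-\alpha)B)\big)\le\lambda^\downarrow\big(f(A)^{\alpha/2}f(B)^{1-\alpha}f(A)^{\alpha/2}U\big). $$ If $f$ is log-concave, then there exists an $n\times n$ unitary matrix $U$ such that the reverse inequality holds: $$ \lambda^\downarrow\big(f(\alpha A+(1-\alpha)B)\big)\ge\lambda^\downarrow\big(f(A)^{\alpha/2}f(B)^{1-\alpha}f(A)^{\alpha/2}U\big). $$
   Context: A positive function $f$ is log-convex (resp. log-concave) if $\log f$ is convex (resp. concave). Monotone means either nondecreasing or nonincreasing. For Hermitian $H$, $f(H)$ is defined by the spectral functional calculus. For an $n\times n$ matrix $X$ with real eigenvalues, $\lambda^\downarrow(X)$ is the vector of eigenvalues of $X$, with (algebraic) multiplicity, in decreasing order; it is part of the assertion that $U$ can be chosen so that the eigenvalues of $f(A)^{\alpha/2}f(B)^{1-\alpha}f(A)^{\alpha/2}U$ are real. Inequalities between vectors are entrywise. *)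

(* Defs.v *)
From HB Require Import structures.
From mathcomp Require Export all_boot all_order all_algebra.
From mathcomp Require Export complex.
From mathcomp Require Export all_classical all_reals all_analysis.

Set Implicit Arguments.
Unset Strict Implicit.
Unset Printing Implicit Defensive.

Import Order.TTheory GRing.Theory Num.Theory.
Import numFieldNormedType.Exports.
Local Open Scope classical_set_scope.
Local Open Scope ring_scope.
Local Open Scope complex_scope.
Local Open Scope sesquilinear_scope.

Definition monotone_on (R : realType) (I : interval R) (f : R -> R) : Prop :=
  {in I &, {homo f : x y / x <= y}} \/ {in I &, {homo f : x y / x <= y >-> y <= x}}.

Definition log_convex_on (R : realType) (I : interval R) (f : R -> R) : Prop :=
  convex_function ([set` I] : set (convex_lmodType R^o)) (fun x => ln (f x)).

Definition log_concave_on (R : realType) (I : interval R) (f : R -> R) : Prop :=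
  convex_function ([set` I] : set (convex_lmodType R^o)) (fun x => - ln (f x)).

Definition spectrum_in (R : realType) (n : nat) (A : 'M[R[i]]_n)
    (I : interval R) : Prop :=
  forall z : R[i], eigenvalue A z -> exists2 x : R, x \in I & z = x%:C.

(* For Hermitian H, [spectral_diag H] has real entries, so taking real parts
   loses nothing and the result does not depend on the chosen spectral
   decomposition. For other matrices the value is meaningless. *)
Definition hermfun (R : realType) (n : nat) (f : R -> R) (H : 'M[R[i]]_n) :
    'M[R[i]]_n :=
  invmx (spectralmx H)
  *m diag_mx (map_mx (fun z => (f (complex.Re z))%:C) (spectral_diag H))
  *m spectralmx H.

Definition hermpow (R : realType) (n : nat) (H : 'M[R[i]]_n) (p : R) :
    'M[R[i]]_n :=
  hermfun (fun t => t `^ p) H.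

Definition eigenvalues (R : realType) (n : nat) (X : 'M[R[i]]_n) : seq R[i] :=
  sval (closed_field_poly_normal (char_poly X)).

Definition real_eigenvalues (R : realType) (n : nat) (X : 'M[R[i]]_n) : Prop :=
  forall z : R[i], eigenvalue X z -> z \is Num.real.

(* Only meaningful under [real_eigenvalues X]. The list being sorted has length n
   because [char_poly X] is monic of degree n, so the default value of
   the sequence indexing is never used. *)
Definition lambda_down (R : realType) (n : nat) (X : 'M[R[i]]_n) : 'rV[R]_n :=
  \row_i (sort >=%R [seq complex.Re z | z <- eigenvalues X])`_i.

Definition le_vec (R : realType) (n : nat) (u v : 'rV[R]_n) : Prop :=
  forall i : 'I_n, u 0 i <= v 0 i.

(* Main.v *)
Require Import Defs.
From HB Require Import structures.
From mathcomp Require Import perm ring lra.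

(** With [g = ln f], [a = alpha g(A)], [b = (1 - alpha) g(B)] and [K = a + b], the
    matrix of the statement is [P U], where [P = e^(a/2) e^b e^(a/2)]. One unitary
    [U], independent of the convexity of [g], serves both parts: it is chosen so
    that the spectrum of [P U] is exactly that of [e^K]. By Horn's converse of
    Weyl's majorant theorem such a [U] exists as soon as the eigenvalues of [e^K]
    are log-majorized by those of [P], which is the Golden-Thompson inequality in
    its strong form. The latter follows from Weyl's inequality, which gives
    log-majorization of [P(t)^2] by [P(2t)] for
    [P(t) = e^(ta/2) e^(tb) e^(ta/2)], and from
    [P(t) >= 1 + t K - O(t^2)] as [t] tends to [0].
    It remains to compare the eigenvalues of [g (alpha A + (1 - alpha) B)] and
    [K] one by one, which is the Courant-Fischer argument combined with Jensen's
    inequality for the spectral measures of [A] and [B]; monotonicity of [g] lets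
    the eigenvalues of [alpha A + (1 - alpha) B] be sorted by their images. *)

Import Order.TTheory GRing.Theory Num.Theory.
Local Open Scope ring_scope.
Local Open Scope complex_scope.
Local Open Scope sesquilinear_scope.

Set Implicit Arguments.
Unset Strict Implicit.
Unset Printing Implicit Defensive.

(** * Quadratic forms of unitarily diagonalized matrices *)

(** For Hermitian [M] the entry is already real; the real part only moves it to the ordered field
    [R]. *)
HB.lock Definition qform (R : realType) k (M : 'M[R[i]]_k) (x : 'rV[R[i]]_k) : R :=
  complex.Re ((x *m M *m x^t*) 0 0).

(** Vectors are rows: row [i] of a unitary [U] is an eigenvector for the eigenvalue [d 0 i]. Since
    [d] is real, the matrix is Hermitian. *)
HB.lock Definition udiag (R : realType) n (U : 'M[R[i]]_n) (d : 'rV[R]_n) : 'M[R[i]]_n :=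
  U^t* *m diag_mx (map_mx (real_complex R) d) *m U.

Section QuadraticForms.
Variable R : realType.
Local Notation C := R[i].

Definition nsq (z : C) : R := complex.Re z ^+ 2 + complex.Im z ^+ 2.
Definition sqn k (x : 'rV[C]_k) : R := \sum_i nsq (x 0 i).

Lemma nsq_ge0 z : 0 <= nsq z.
Proof. by rewrite addr_ge0 // sqr_ge0. Qed.

Lemma nsq0 : nsq 0 = 0.
Proof. by rewrite /nsq /= expr0n addr0. Qed.

Lemma nsq_eq0 z : (nsq z == 0) = (z == 0).
Proof.
rewrite /nsq paddr_eq0 ?sqr_ge0 // !sqrf_eq0.
by case: z => a b; rewrite eq_complex.
Qed.

Lemma nsqE z : z * z^* = (nsq z)%:C.
Proof. by rewrite -normCK add_Re2_Im2. Qed.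

Lemma nsqZ (c : R) z : nsq (c%:C * z) = c ^+ 2 * nsq z.
Proof. by case: z => a b; rewrite /nsq /=; ring. Qed.

Lemma ReD (x y : C) : complex.Re (x + y) = complex.Re x + complex.Re y.
Proof. by case: x y => ? ? []. Qed.

Lemma Re_sum (I : Type) (r : seq I) (P : pred I) (F : I -> C) :
  complex.Re (\sum_(i <- r | P i) F i) = \sum_(i <- r | P i) complex.Re (F i).
Proof. by apply: (big_morph (@complex.Re R)) => // x y; rewrite ReD. Qed.

Lemma trmxC_mul m n p (A : 'M[C]_(m, n)) (B : 'M[C]_(n, p)) :
  (A *m B)^t* = B^t* *m A^t*.
Proof. by rewrite trmx_mul map_mxM. Qed.

Lemma unitarymx_trK n (U : 'M[C]_n) : U \is unitarymx -> U^t* *m U = 1%:M.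
Proof. by move=> /unitarymxP/mulmx1C. Qed.

Lemma sqnE k (x : 'rV[C]_k) : (x *m x^t*) 0 0 = (sqn x)%:C.
Proof.
by rewrite mxE raddf_sum; apply: eq_bigr => i _; rewrite !mxE nsqE.
Qed.

Lemma sqn_ge0 k (x : 'rV[C]_k) : 0 <= sqn x.
Proof. by rewrite sumr_ge0 // => i _; exact: nsq_ge0. Qed.

Lemma sqn_gt0 k (x : 'rV[C]_k) : x != 0 -> 0 < sqn x.
Proof.
rewrite lt_def sqn_ge0 andbT; apply: contra_neq => /eqP.
rewrite psumr_eq0 => [/allP x0|i _]; last exact: nsq_ge0.
apply/rowP => i; have := x0 i (mem_index_enum _).
by rewrite nsq_eq0 mxE => /eqP.
Qed.

Lemma sqn_unitary k n (x : 'rV[C]_k) (Q : 'M[C]_(k, n)) :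
  Q \is unitarymx -> sqn (x *m Q) = sqn x.
Proof.
move=> Qu; apply: (@complexI R); rewrite -!sqnE trmxC_mul mulmxA mulmxtVK //.
Qed.

Lemma sqnZ k (c : R) (x : 'rV[C]_k) : sqn (c%:C *: x) = c ^+ 2 * sqn x.
Proof. by rewrite /sqn mulr_sumr; apply: eq_bigr => i _; rewrite mxE nsqZ. Qed.

Lemma qformD k (M N : 'M[C]_k) x : qform (M + N) x = qform M x + qform N x.
Proof. by rewrite qform.unlock mulmxDr mulmxDl mxE ReD. Qed.

Lemma qformZ k (c : R) (M : 'M[C]_k) x : qform (c%:C *: M) x = c * qform M x.
Proof.
rewrite qform.unlock -scalemxAr -scalemxAl mxE.
by case: ((x *m M *m x^t*) 0 0) => a b /=; rewrite mul0r subr0.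
Qed.

Lemma qform_compress k n (Q : 'M[C]_(k, n)) (M : 'M[C]_n) x :
  qform (Q *m M *m Q^t*) x = qform M (x *m Q).
Proof. by rewrite qform.unlock trmxC_mul !mulmxA. Qed.

(** For unitary [U] the weights are the spectral measure at [x]: squared moduli of its coordinates
    in the eigenbasis. *)
Lemma qform_udiag n (U : 'M[C]_n) d x :
  qform (udiag U d) x = \sum_i nsq ((x *m U^t*) 0 i) * d 0 i.
Proof.
rewrite qform.unlock udiag.unlock !mulmxA -[_ *m U *m _]mulmxA.
have -> : U *m x^t* = (x *m U^t*)^t* by rewrite trmxC_mul trmxCK.
rewrite mul_mx_diag mxE Re_sum; apply: eq_bigr => i _.
by rewrite !mxE mulrAC nsqE -rmorphM.
Qed.

Lemma udiag_herm n (U : 'M[C]_n) d : (udiag U d)^t* = udiag U d.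
Proof.
have dE : map_mx Num.conj_op (map_mx (real_complex R) d) = map_mx (real_complex R) d.
  by apply/rowP => i; rewrite !mxE; exact: conjc_real.
by rewrite udiag.unlock !trmxC_mul trmxCK mulmxA tr_diag_mx map_diag_mx dE.
Qed.

Lemma udiagM n (U : 'M[C]_n) d e : U \is unitarymx ->
  udiag U d *m udiag U e = udiag U (\row_i (d 0 i * e 0 i)).
Proof.
move=> Uu; rewrite udiag.unlock -!mulmxA (mulmxA U) (unitarymxP Uu) mul1mx.
rewrite (mulmxA (diag_mx _)) mulmx_diag.
have -> : map_mx (real_complex R) (\row_i (d 0 i * e 0 i)) = 
   \row_i (map_mx (real_complex R) d 0 i * map_mx (real_complex R) e 0 i).
  by apply/rowP => i; rewrite !mxE rmorphM.
by [].
Qed.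

Lemma left_null_col0 (F : fieldType) k (A : 'M[F]_k) (j : 'I_k) :
  (forall i, A i j = 0) -> exists2 x : 'rV_k, x != 0 & x *m A = 0.
Proof.
move=> Aj0; apply/det0P; rewrite (expand_det_col A j) big1 // => i _.
by rewrite Aj0 mul0r.
Qed.

(* The Courant-Fischer argument: the span of the first [j.+1] rows of one basis
   meets the span of the rows of index at least [j] of another. *)
Lemma test_vector k n (le_kn : (k <= n)%N) (V : 'M[C]_(k, k)) (W : 'M[C]_(k, n))
    (j : 'I_k) :
  exists x : 'rV[C]_k, [/\ sqn x = 1,
    forall i : 'I_k, (j < i)%N -> (x *m V) 0 i = 0 &
    forall i : 'I_n, (i < j)%N -> (x *m W) 0 i = 0].
Proof.
(* The columns gather the [k - 1] linear conditions on [x]; column [j] is left zero, so [A] is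
   singular and has a nonzero left null vector. *)
pose A : 'M[C]_k := \matrix_(r, i)
  if (j < i)%N then V r i else if (i < j)%N then W r (widen_ord le_kn i) else 0.
have [i|x x_neq0 xA] := @left_null_col0 _ k A j; first by rewrite mxE ltnn.
have sx := sqn_gt0 x_neq0.
exists ((Num.sqrt (sqn x))^-1%:C *: x); split.
- by rewrite sqnZ exprVn sqr_sqrtr ?sqn_ge0 // mulVf // gt_eqF.
- move=> i ji; rewrite -scalemxAl mxE; apply/eqP; rewrite mulf_eq0; apply/orP; right.
  have := congr1 (fun N : 'rV_k => N 0 i) xA; rewrite !mxE => xAi.
  apply/eqP; rewrite -[RHS]xAi; apply: eq_bigr => r _; by rewrite mxE ji.
- move=> i ij; rewrite -scalemxAl mxE; apply/eqP; rewrite mulf_eq0; apply/orP; right.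
  pose i' := Ordinal (ltn_trans ij (ltn_ord j)).
  have := congr1 (fun N : 'rV_k => N 0 i') xA; rewrite !mxE => xAi.
  apply/eqP; rewrite -[RHS]xAi; apply: eq_bigr => r _; rewrite mxE /= ij ltnNge ltnW //=.
  by congr (_ * W r _); apply: val_inj.
Qed.

Lemma wavg_ge n (w d : 'I_n -> R) c : (forall i, 0 <= w i) -> \sum_i w i = 1 ->
  (forall i, w i != 0 -> c <= d i) -> c <= \sum_i w i * d i.
Proof.
move=> w0 w1 cd; rewrite -[c]mul1r -w1 mulr_suml; apply: ler_sum => i _.
by have [->|/cd] := eqVneq (w i) 0; rewrite ?mul0r // => ?; rewrite ler_wpM2l.
Qed.

Lemma wavg_le n (w d : 'I_n -> R) c : (forall i, 0 <= w i) -> \sum_i w i = 1 ->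
  (forall i, w i != 0 -> d i <= c) -> \sum_i w i * d i <= c.
Proof.
move=> w0 w1 cd; rewrite -[c]mul1r -w1 mulr_suml; apply: ler_sum => i _.
by have [->|/cd] := eqVneq (w i) 0; rewrite ?mul0r // => ?; rewrite ler_wpM2l.
Qed.

Lemma nsq_neq0_supp n (x : 'rV[C]_n) (P : pred 'I_n) :
  (forall i, ~~ P i -> x 0 i = 0) -> forall i, nsq (x 0 i) != 0 -> P i.
Proof. by move=> xP i; apply: contraNT => /xP ->; rewrite nsq0. Qed.

Definition nonincr n (d : 'rV[R]_n) := forall i j : 'I_n, (i <= j)%N -> d 0 j <= d 0 i.

(** On the vector of [test_vector] the form of [udiag U d] is at least [d 0 j] and, after the
    isometry [Q], that of [udiag V e] is at most the entry of [e] of index [j]. Taking [c = 0] and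
    [t = 1] gives interlacing for compressions; general [c] and [t] serve the first-order bound on
    [P(t)]. *)
Lemma courant_le k n (le_kn : (k <= n)%N) (Q : 'M[C]_(k, n))
    (U : 'M[C]_k) (V : 'M[C]_n) (d : 'rV[R]_k) (e : 'rV[R]_n) (c t : R) :
  Q \is unitarymx -> U \is unitarymx -> V \is unitarymx ->
  nonincr d -> nonincr e -> 0 <= t ->
  (forall x, sqn x = 1 -> c + t * qform (udiag U d) x <= qform (udiag V e) (x *m Q)) ->
  forall j, c + t * d 0 j <= e 0 (widen_ord le_kn j).
Proof.
move=> Qu Uu Vu dd de t0 le_form j.
have [x [x1 xU xV]] := test_vector le_kn (U^t*) (Q *m V^t*) j.
apply: le_trans (_ : c + t * qform (udiag U d) x <= _).
  rewrite lerD2l ler_wpM2l // qform_udiag; apply: wavg_ge => [i||].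
  - exact: nsq_ge0.
  - by rewrite -[LHS]/(sqn _) sqn_unitary ?trmxC_unitary.
  apply: (@nsq_neq0_supp _ _ (fun i => d 0 j <= d 0 i)) => i.
  by move=> nd; apply: xU; rewrite ltnNge; apply: contra nd => /dd.
apply: le_trans (le_form x x1) _.
rewrite qform_udiag -mulmxA; apply: wavg_le => [i||].
- exact: nsq_ge0.
- rewrite -[LHS]/(sqn _) mulmxA !sqn_unitary ?trmxC_unitary //.
apply: (@nsq_neq0_supp _ _ (fun i => e 0 i <= e 0 (widen_ord le_kn j))) => i.
by move=> nd; apply: xV; rewrite ltnNge; apply: contra nd => ji; apply: de.
Qed.

End QuadraticForms.

(** * Spectral decompositions *)

(** The change of basis [V *m U^t*] turns the equality of two decompositions into a relation that,
    for diagonal [D] and [E], is read entry by entry. *)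
Lemma unitary_intertwine (C : numClosedFieldType) n (U V D E : 'M[C]_n) :
  U \is unitarymx -> V \is unitarymx ->
  (U^t* *m D *m U = V^t* *m E *m V) <-> (E *m (V *m U^t*) = V *m U^t* *m D).
Proof.
move=> Uu Vu; split => [eq_UV|eqW].
  transitivity (V *m (V^t* *m E *m V) *m U^t*).
    by rewrite !mulmxA (unitarymxP Vu) mul1mx.
  by rewrite -eq_UV -!mulmxA (unitarymxP Uu) mulmx1 !mulmxA.
transitivity (V^t* *m (V *m U^t* *m D) *m U).
  by rewrite !mulmxA (mulmx1C (unitarymxP Vu)) mul1mx.
by rewrite -eqW -!mulmxA (mulmx1C (unitarymxP Uu)) mulmx1.
Qed.

Section Spectra.
Variable R : realType.
Local Notation C := R[i].

Lemma udiagE n (U : 'M[C]_n) (d : 'rV[R]_n) r s :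
  udiag U d r s = \sum_i (U i r)^* * (d 0 i)%:C * U i s.
Proof.
rewrite udiag.unlock mul_mx_diag mxE; apply: eq_bigr => i _.
by rewrite !mxE.
Qed.

(** A nonzero entry [W i j] of the change of basis forces [e 0 i = d 0 j], hence equal images under
    [f]. Thus the functional calculus is independent of the decomposition. *)
Lemma udiag_inj_fun (f : R -> R) n (U V : 'M[C]_n) d e :
  U \is unitarymx -> V \is unitarymx -> udiag U d = udiag V e ->
  udiag U (map_mx f d) = udiag V (map_mx f e).
Proof.
rewrite udiag.unlock => Uu Vu /(unitary_intertwine _ _ Uu Vu) eqW.
apply/(unitary_intertwine _ _ Uu Vu).
move: (V *m U^t*) eqW => W eqW.
apply/matrixP => i j; have := congr1 (fun M : 'M[C]_n => M i j) eqW.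
rewrite !mul_mx_diag !mul_diag_mx !mxE mulrC => /eqP.
rewrite -subr_eq0 -mulrBr mulf_eq0 => /orP[/eqP->|]; first by rewrite mulr0 mul0r.
by rewrite subr_eq0 => /eqP/complexI ->; rewrite mulrC.
Qed.

Lemma herm_udiag n (A : 'M[C]_n) : A \is hermsymmx ->
  A = udiag (spectralmx A) (map_mx (@complex.Re R) (spectral_diag A)).
Proof.
move=> Ah; have /orthomx_spectralP {1} -> := hermitian_normalmx Ah.
rewrite (invmx_unitary (spectral_unitarymx A)) udiag.unlock -map_mx_comp.
have -> : map_mx (real_complex R \o complex.Re (R:=R)) (spectral_diag A) = spectral_diag A.
  apply/rowP => i; rewrite mxE /=; apply: RRe_real.
  by have /mxOverP := hermitian_spectral_diag_real Ah.
by [].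
Qed.

Lemma hermfunE (f : R -> R) n (U : 'M[C]_n) d : U \is unitarymx ->
  hermfun f (udiag U d) = udiag U (map_mx f d).
Proof.
move=> Uu; set A := udiag U d.
have Ah : A \is hermsymmx.
  by apply/is_hermitianmxP; rewrite scale1r /A udiag_herm.
rewrite /hermfun (invmx_unitary (spectral_unitarymx A)).
have -> : map_mx (fun z => (f (complex.Re z))%:C) (spectral_diag A) =
   map_mx (real_complex R) (map_mx f (map_mx (@complex.Re R) (spectral_diag A))).
  by rewrite -!map_mx_comp.
transitivity (udiag (spectralmx A) (map_mx f (map_mx (@complex.Re R) (spectral_diag A)))).
  by rewrite udiag.unlock.
apply: (udiag_inj_fun f (spectral_unitarymx A) Uu).
by rewrite -(herm_udiag Ah).
Qed.

Lemma row_perm_unitary n (p : 'S_n) (U : 'M[C]_n) :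
  U \is unitarymx -> row_perm p U \is unitarymx.
Proof.
move=> /unitarymxP Uu; apply/unitarymxP/matrixP => i j.
have := congr1 (fun M : 'M[C]_n => M (p i) (p j)) Uu; rewrite !mxE => E.
rewrite (inj_eq (@perm_inj _ p)) in E; rewrite -E.
by apply: eq_bigr => k _; rewrite !mxE.
Qed.

Lemma udiag_perm n (p : 'S_n) (U : 'M[C]_n) (d : 'rV[R]_n) :
  udiag (row_perm p U) (col_perm p d) = udiag U d.
Proof.
apply/matrixP => r s; rewrite !udiagE [RHS](reindex_inj (@perm_inj _ p)) /=.
by apply: eq_bigr => i _; rewrite !mxE.
Qed.

Lemma sorting_perm n (key : 'I_n -> R) :
  exists p : 'S_n, forall i j : 'I_n, (i <= j)%N -> key (p j) <= key (p i).
Proof.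
pose r i j := key j <= key i.
have rt : total r by move=> i j; exact: le_total.
have rtr : transitive r by move=> i j k ij jk; exact: le_trans jk ij.
pose t := sort_tuple r (ord_tuple n).
have /tuple_permP[p tp] : perm_eq t (ord_tuple n) by rewrite perm_sort.
exists p => i j ij.
have tE k : tnth t k = p k by rewrite (tnth_nth k) tp -tnth_nth tnth_mktuple tnth_ord_tuple.
rewrite -!tE -/(r _ _) !(tnth_nth i).
apply: sorted_leq_nth => //; rewrite ?inE ?size_tuple //.
- by move=> k; rewrite /r.
- by apply: sort_sorted.
Qed.

(** The identity as [key] orders the eigenvalues themselves; another [key] orders them by their
    images, so that the spectrum of the image matrix comes out sorted. *)
Lemma herm_sorted n (A : 'M[C]_n) (key : R -> R) : A \is hermsymmx ->
  exists U d, [/\ U \is unitarymx, A = udiag U d & nonincr (map_mx key d)].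
Proof.
move=> Ah; set d := map_mx (@complex.Re R) (spectral_diag A).
have [p sp] := sorting_perm (fun i => key (d 0 i)).
exists (row_perm p (spectralmx A)), (col_perm p d); split.
- exact/row_perm_unitary/spectral_unitarymx.
- by rewrite udiag_perm -herm_udiag.
- by move=> i j ij; rewrite !mxE; have := sp i j ij; rewrite !mxE.
Qed.

(** * Characteristic polynomials and sorted eigenvalue lists *)

Lemma char_poly_conj (F : comNzRingType) n (P Q A : 'M[F]_n) :
  P *m Q = 1%:M -> char_poly (P *m A *m Q) = char_poly A.
Proof.
move=> PQ; rewrite /char_poly /char_poly_mx !map_mxM /=.
have PQ' : map_mx (@polyC F) P *m map_mx (@polyC F) Q = 1%:M by rewrite -map_mxM PQ map_mx1.
rewrite -[X in \det (X - _)]mulmx1 -PQ' mulmxA -scalar_mxC -mulmxBl -mulmxBr.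
by rewrite !det_mulmx mulrAC -det_mulmx PQ' det1 mul1r.
Qed.

Lemma char_poly_udiag n (U : 'M[C]_n) (d : 'rV[R]_n) : U \is unitarymx ->
  char_poly (udiag U d) = \prod_i ('X - ((d 0 i)%:C)%:P).
Proof.
move=> Uu; rewrite udiag.unlock char_poly_conj ?unitarymx_trK // char_poly_trig.
  by apply: eq_bigr => i _; rewrite !mxE eqxx.
exact: diag_mx_is_trig.
Qed.

Lemma nonincr_sorted n (d : 'rV[R]_n) : nonincr d ->
  sorted >=%R [seq d 0 i | i <- enum 'I_n].
Proof.
move=> dd; apply/(sortedP 0) => i; rewrite size_map size_enum_ord => lti.
have lt' := ltnW lti.
rewrite !(nth_map (Ordinal lti)) -?enumT ?size_enum_ord //.
by apply: dd; rewrite !nth_enum_ord.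
Qed.

(** The roots of the characteristic polynomial, with multiplicity, determine the sorted list. This
    covers the product [P U], which may fail to be normal. *)
Lemma lambda_downE n (X : 'M[C]_n) (d : 'rV[R]_n) : nonincr d ->
  char_poly X = \prod_i ('X - ((d 0 i)%:C)%:P) ->
  real_eigenvalues X /\ lambda_down X = d.
Proof.
move=> dd cX; split.
  move=> z; rewrite eigenvalue_root_char cX.
  have -> : \prod_i ('X - ((d 0 i)%:C)%:P)
      = \prod_(x <- [seq (d 0 i)%:C | i <- enum 'I_n]) ('X - x%:P).
    by rewrite big_map big_enum.
  rewrite root_prod_XsubC => /mapP[i _ ->].
  by apply/complex_realP; exists (d 0 i).
have : perm_eq (eigenvalues X) [seq (d 0 i)%:C | i <- enum 'I_n].
  rewrite /eigenvalues; case: closed_field_poly_normal => r /= Er.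
  apply: prod_XsubC_eq; rewrite big_map big_enum /= -cX Er.
  by rewrite (monicP (char_poly_monic X)) scale1r.
move=> /(perm_map (@complex.Re R)); rewrite -map_comp /= => pE.
have sE : sort >=%R [seq complex.Re z | z <- eigenvalues X] = [seq d 0 i | i <- enum 'I_n].
  have get : transitive (>=%R : rel R) by move=> a b c ab bc; exact: le_trans bc ab.
  apply: (sorted_eq (leT := >=%R)) => //.
  - by move=> a b /andP[ab ba]; apply/eqP; rewrite eq_le; apply/andP.
  - by apply: sort_sorted => a b; exact: le_total.
  - exact: nonincr_sorted.
  - by rewrite perm_sort.
apply/rowP => i; rewrite mxE sE (nth_map i) ?size_enum_ord //.
by congr (d 0 _); apply: val_inj; rewrite /= nth_enum_ord.
Qed.

Lemma lambda_down_udiag n (U : 'M[C]_n) (d : 'rV[R]_n) : U \is unitarymx ->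
  nonincr d -> lambda_down (udiag U d) = d.
Proof. by move=> Uu dd; have [] := lambda_downE dd (char_poly_udiag d Uu). Qed.

Lemma det_udiag n (U : 'M[C]_n) (d : 'rV[R]_n) : U \is unitarymx ->
  \det (udiag U d) = (\prod_i d 0 i)%:C.
Proof.
move=> Uu; rewrite udiag.unlock !det_mulmx mulrAC -det_mulmx unitarymx_trK // det1 mul1r det_diag.
by rewrite rmorph_prod; apply: eq_bigr => i _; rewrite mxE.
Qed.

End Spectra.

(** * Eigenvalues of convex functions *)

Section Jensen.
Variable R : realType.
Local Notation C := R[i].

Lemma convex_function2 (I : interval R) (g : R -> R) (x y t : R) :
  convex_function ([set` I] : set (convex_lmodType R^o)) g ->
  x \in I -> y \in I -> 0 <= t <= 1 ->
  t * x + (1 - t) * y \in I /\ g (t * x + (1 - t) * y) <= t * g x + (1 - t) * g y.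
Proof.
move=> gI xI yI /andP[t0 t1]; split; last first.
  by have := gI (Itv01 t0 t1) x y; apply; rewrite inE.
(* Exchanging [x] and [y] replaces [t] by [1 - t]; once [x <= y], the combination lies between two
   points of the interval. *)
wlog le_xy : x y t xI yI t0 t1 / x <= y => [th|].
  have [/th|/ltW le_yx] := leP x y; first exact.
  have -> : t * x + (1 - t) * y = (1 - t) * y + (1 - (1 - t)) * x by ring.
  by apply: th => //; rewrite ?subr_ge0 ?gerBl.
apply: (@interval_is_interval _ I x y) => //=; apply/andP; split; nra.
Qed.

(** Induction on the number of points: the first one is split off, the others are averaged with
    weights renormalized by their sum [s], and the two-point inequality joins both. If [s = 0], all
    the mass sits at the first point. *)
Lemma jensen (I : interval R) (g : R -> R) n (w d : 'I_n -> R) :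
  convex_function ([set` I] : set (convex_lmodType R^o)) g ->
  (forall i, 0 <= w i) -> \sum_i w i = 1 -> (forall i, d i \in I) ->
  \sum_i w i * d i \in I /\ g (\sum_i w i * d i) <= \sum_i w i * g (d i).
Proof.
move=> gI; elim: n w d => [|n IH] w d w0 w1 dI.
  by move: w1; rewrite big_ord0 => /eqP; rewrite eq_sym oner_eq0.
rewrite !big_ord_recl; set s := \sum_(i < n) w (lift ord0 i).
have w0E : w ord0 = 1 - s by move: w1; rewrite big_ord_recl -/s => <-; ring.
have s0 : 0 <= s by rewrite sumr_ge0.
have [s_eq0|s_neq0] := eqVneq s 0.
  have wz i : w (lift ord0 i) = 0.
    apply/eqP; move/eqP: s_eq0; rewrite psumr_eq0 // => /allP /(_ i).
    by rewrite mem_index_enum; apply.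
  rewrite !big1 ?addr0 => [|i _|i _]; rewrite ?wz ?mul0r //.
  by rewrite w0E s_eq0 subr0 !mul1r; split.
pose w' i := w (lift ord0 i) / s.
have [|||avgI le_avg] := IH w' (fun i => d (lift ord0 i)).
- by move=> i; rewrite divr_ge0.
- by rewrite -mulr_suml divff.
- by move=> i.
have sE (F : 'I_n -> R) : \sum_(i < n) w (lift ord0 i) * F i = s * \sum_i w' i * F i.
  rewrite mulr_sumr; apply: eq_bigr => i _.
  by rewrite /w' mulrA [s * _]mulrC divfK.
rewrite !sE.
have sw : s = 1 - w ord0 by rewrite w0E; ring.
have w01 : 0 <= w ord0 <= 1 by rewrite w0 w0E gerBl.
have [cI cg] := convex_function2 gI (dI ord0) avgI w01.
rewrite sw; split => //; apply: le_trans cg _.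
by rewrite lerD2l -sw ler_wpM2l.
Qed.

(** In case of equality the nonnegative terms [w i * (d i - c)] sum to zero, so every weight
    vanishes, against their sum being [1]. *)
Lemma wavg_gt n (w d : 'I_n -> R) c : (forall i, 0 <= w i) -> \sum_i w i = 1 ->
  (forall i, w i != 0 -> c < d i) -> c < \sum_i w i * d i.
Proof.
move=> w0 w1 cd; rewrite lt_neqAle wavg_ge ?andbT => [|//|//|i /cd/ltW //].
apply/eqP => cE; suff : \sum_i w i = 0 by rewrite w1 => /eqP; rewrite oner_eq0.
have : \sum_i w i * (d i - c) = 0.
  under eq_bigr do rewrite mulrBr.
  by rewrite sumrB -mulr_suml w1 mul1r -cE subrr.
have w_ge i : 0 <= w i * (d i - c).
  have [->|/cd lt_cd] := eqVneq (w i) 0; first by rewrite mul0r.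
  by rewrite mulr_ge0 // subr_ge0 ltW.
move/eqP; rewrite psumr_eq0 // => /allP wz; apply: big1 => i _.
have := wz i (mem_index_enum _); rewrite mulf_eq0 => /orP[/eqP //|].
rewrite subr_eq0 => /eqP dc; apply/eqP/negPn/negP => /cd.
by rewrite dc ltxx.
Qed.

Lemma wavg_lt n (w d : 'I_n -> R) c : (forall i, 0 <= w i) -> \sum_i w i = 1 ->
  (forall i, w i != 0 -> d i < c) -> \sum_i w i * d i < c.
Proof.
move=> w0 w1 cd; rewrite -ltrN2 -sumrN.
under eq_bigr do rewrite -mulrN.
by apply: wavg_gt => // i /cd; rewrite ltrN2.
Qed.

(** If [f] were below [y] at the average, monotonicity would put every point carrying weight
    strictly on one side of that average. *)
Lemma monotone_wavg_ge (I : interval R) (f : R -> R) n (w d : 'I_n -> R) y :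
  monotone_on I f -> (forall i, 0 <= w i) -> \sum_i w i = 1 ->
  (forall i, d i \in I) -> \sum_i w i * d i \in I ->
  (forall i, w i != 0 -> y <= f (d i)) -> y <= f (\sum_i w i * d i).
Proof.
move=> fm w0 w1 dI aI le_y; rewrite leNgt; apply/negP => lt_y.
case: fm => fm.
- suff : \sum_i w i * d i < \sum_i w i * d i by rewrite ltxx.
  apply: wavg_gt => // i /le_y yi; rewrite ltNge; apply/negP => di.
  by have := fm _ _ (dI i) aI di; rewrite leNgt (lt_le_trans lt_y yi).
- suff : \sum_i w i * d i < \sum_i w i * d i by rewrite ltxx.
  apply: wavg_lt => // i /le_y yi; rewrite ltNge; apply/negP => di.
  by have := fm _ _ aI (dI i) di; rewrite leNgt (lt_le_trans lt_y yi).
Qed.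

Lemma monotone_onN (I : interval R) (f : R -> R) :
  monotone_on I f -> monotone_on I (fun x => - f x).
Proof.
by case=> fm; [right|left] => x y xI yI xy; rewrite lerN2; apply: fm.
Qed.

Lemma nsq1 : nsq (1 : C) = 1.
Proof. by rewrite /nsq /= expr1n expr0n addr0. Qed.

Lemma qform_row n (U : 'M[C]_n) (d : 'rV[R]_n) j : U \is unitarymx ->
  sqn (row j U) = 1 /\ qform (udiag U d) (row j U) = d 0 j.
Proof.
move=> Uu.
have rE : row j U *m U^t* = delta_mx 0 j.
  by rewrite -row_mul (unitarymxP Uu) row1.
split.
  rewrite -(@sqn_unitary _ _ _ _ (U^t*)) ?trmxC_unitary // rE /sqn (bigD1 j) //=.
  by rewrite big1 ?addr0 => [|i /negPf ij]; rewrite !mxE ?ij ?nsq0 // !eqxx nsq1.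
rewrite qform_udiag rE (bigD1 j) //= big1 ?addr0 => [|i /negPf ij]; rewrite !mxE ?ij.
  by rewrite !eqxx nsq1 mul1r.
by rewrite nsq0 mul0r.
Qed.

Lemma udiag_weights n (U : 'M[C]_n) x : U \is unitarymx -> sqn x = 1 ->
  (forall i, 0 <= nsq ((x *m U^t*) 0 i)) /\ \sum_i nsq ((x *m U^t*) 0 i) = 1.
Proof.
move=> Uu x1; split => [i|]; first exact: nsq_ge0.
by rewrite -[LHS]/(sqn _) sqn_unitary ?trmxC_unitary.
Qed.

Lemma qform_comb k (c c' : R) (M N : 'M[C]_k) x :
  qform (c%:C *: M + c'%:C *: N) x = c * qform M x + c' * qform N x.
Proof. by rewrite qformD (qformZ c) (qformZ c'). Qed.

(** The vector [x] defines a spectral measure for each of the two matrices. Jensen's inequality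
    applies to each, and the two-point inequality to their means. *)
Lemma qform_jensen (I : interval R) (g : R -> R) n (alpha : R)
    (Ua Ub : 'M[C]_n) (a b : 'rV[R]_n) x :
  convex_function ([set` I] : set (convex_lmodType R^o)) g ->
  0 <= alpha <= 1 -> Ua \is unitarymx -> Ub \is unitarymx ->
  (forall i, a 0 i \in I) -> (forall i, b 0 i \in I) -> sqn x = 1 ->
  let H := alpha%:C *: udiag Ua a + (1 - alpha)%:C *: udiag Ub b in
  qform H x \in I /\
  g (qform H x) <= qform (alpha%:C *: udiag Ua (map_mx g a)
                          + (1 - alpha)%:C *: udiag Ub (map_mx g b)) x.
Proof.
move=> gI alpha01 Uau Ubu aI bI x1 H.
have qE (d e : 'rV[R]_n) : qform (alpha%:C *: udiag Ua d + (1 - alpha)%:C *: udiag Ub e) x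
    = alpha * (\sum_i nsq ((x *m Ua^t*) 0 i) * d 0 i)
      + (1 - alpha) * (\sum_i nsq ((x *m Ub^t*) 0 i) * e 0 i).
  by rewrite qform_comb (qform_udiag Ua) (qform_udiag Ub).
rewrite /H (qE a b) (qE (map_mx g a) (map_mx g b)).
have [wa0 wa1] := udiag_weights Uau x1; have [wb0 wb1] := udiag_weights Ubu x1.
have [avgaI ga] := jensen gI wa0 wa1 aI; have [avgbI gb] := jensen gI wb0 wb1 bI.
have [avgI gab] := convex_function2 gI avgaI avgbI alpha01.
split; first exact: avgI.
apply: le_trans gab _; case/andP: alpha01 => al0 al1.
apply: lerD; apply: ler_wpM2l => //; rewrite ?subr_ge0 //.
  apply: le_trans ga _; apply: ler_sum => i _; by rewrite [map_mx g a 0 i]mxE.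
apply: le_trans gb _; apply: ler_sum => i _; by rewrite [map_mx g b 0 i]mxE.
Qed.

Lemma combination_eig_mem (I : interval R) (g : R -> R) n (alpha : R)
    (Ua Ub U : 'M[C]_n) (a b h : 'rV[R]_n) :
  convex_function ([set` I] : set (convex_lmodType R^o)) g ->
  0 <= alpha <= 1 -> Ua \is unitarymx -> Ub \is unitarymx ->
  (forall i, a 0 i \in I) -> (forall i, b 0 i \in I) -> U \is unitarymx ->
  alpha%:C *: udiag Ua a + (1 - alpha)%:C *: udiag Ub b = udiag U h ->
  forall j, h 0 j \in I.
Proof.
move=> gI al01 Uau Ubu aI bI Uu HE j; have [r1 <-] := qform_row h j Uu.
by rewrite -HE; have [] := qform_jensen gI al01 Uau Ubu aI bI r1.
Qed.

(** For a suitable unit vector [x], [g (h 0 j)] is at most [g] of the form of [udiag U h] at [x],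
    then at most the form of [udiag V k] at [x], then at most [k 0 j]. The increasing alternative
    for the orderings serves the log-concave case, where signs are reversed. *)
Lemma convex_eig_le (I : interval R) (g : R -> R) n (alpha : R)
    (Ua Ub U V : 'M[C]_n) (a b h k : 'rV[R]_n) :
  convex_function ([set` I] : set (convex_lmodType R^o)) g -> monotone_on I g ->
  0 <= alpha <= 1 -> Ua \is unitarymx -> Ub \is unitarymx ->
  (forall i, a 0 i \in I) -> (forall i, b 0 i \in I) ->
  U \is unitarymx -> V \is unitarymx ->
  alpha%:C *: udiag Ua a + (1 - alpha)%:C *: udiag Ub b = udiag U h ->
  alpha%:C *: udiag Ua (map_mx g a) + (1 - alpha)%:C *: udiag Ub (map_mx g b)
    = udiag V k ->
  nonincr (map_mx g h) /\ nonincr k \/ nonincr (- map_mx g h) /\ nonincr (- k) ->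
  forall j, g (h 0 j) <= k 0 j.
Proof.
move=> gI gm al01 Uau Ubu aI bI Uu Vu HE KE sorted.
have qJ x : sqn x = 1 ->
    qform (udiag U h) x \in I /\ g (qform (udiag U h) x) <= qform (udiag V k) x.
  by move=> x1; rewrite -HE -KE; exact: qform_jensen.
have hI := combination_eig_mem gI al01 Uau Ubu aI bI Uu HE.
move=> j.
have [x [x1 xU xV]] : exists x, [/\ sqn x = 1,
    forall i, ~~ (g (h 0 j) <= g (h 0 i)) -> (x *m U^t*) 0 i = 0 &
    forall i, ~~ (k 0 i <= k 0 j) -> (x *m V^t*) 0 i = 0].
  (* In the decreasing case [x] lies in the span of the rows of [U] of index at most [j] and of the
     rows of [V] of index at least [j]; in the increasing case the roles are exchanged. *)
  case: sorted => -[gh kh].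
    have [x [x1 xU xV]] := test_vector (leqnn n) (U^t*) (V^t*) j.
    exists x; split => // i ij; [apply: xU|apply: xV]; rewrite ltnNge; apply: contra ij.
      by move=> /gh; rewrite !mxE.
    by move/kh.
  have [x [x1 xV xU]] := test_vector (leqnn n) (V^t*) (U^t*) j.
  exists x; split => // i ij; [apply: xU|apply: xV]; rewrite ltnNge; apply: contra ij.
    by move=> /gh; rewrite !mxE lerN2.
  by move/kh; rewrite !mxE lerN2.
have [qI] := qJ x x1; move/le_trans.
rewrite (qform_udiag U) in qI *; rewrite (qform_udiag V).
have [wU0 wU1] := udiag_weights Uu x1; have [wV0 wV1] := udiag_weights Vu x1.
have le1 : g (h 0 j) <= g (\sum_i nsq ((x *m U^t*) 0 i) * h 0 i).
  apply: (@monotone_wavg_ge I) => //.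
  exact: (@nsq_neq0_supp _ _ _ (fun i => g (h 0 j) <= g (h 0 i))).
move=> le2; apply: le_trans le1 (le2 _ _); apply: wavg_le => //.
exact: (@nsq_neq0_supp _ _ _ (fun i => k 0 i <= k 0 j)).
Qed.

End Jensen.

(** * Weyl's inequality *)

Section Doubling.
Variable R : realType.
Local Notation C := R[i].

(** The determinant is the product of the eigenvalues of the Hermitian compression. These are
    nonnegative, and by interlacing each is at most the [q] of the same index. *)
Lemma compress_det_le k n (le_kn : (k <= n)%N) (Q : 'M[C]_(k, n))
    (W : 'M[C]_n) (q : 'rV[R]_n) :
  Q \is unitarymx -> W \is unitarymx -> nonincr q -> (forall i, 0 <= q 0 i) ->
  exists2 c : R, \det (Q *m udiag W q *m Q^t*) = c%:C &
    c <= \prod_(i < k) q 0 (widen_ord le_kn i).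
Proof.
move=> Qu Wu dq q0; pose N := Q *m udiag W q *m Q^t*.
have Nh : N \is hermsymmx.
  apply/is_hermitianmxP; rewrite scale1r /N.
  by rewrite trmxC_mul trmxC_mul trmxCK udiag_herm mulmxA.
have [U [c [Uu NE dc]]] := herm_sorted id Nh.
exists (\prod_i c 0 i); first by rewrite -/N NE det_udiag.
have qNE x : qform (udiag U c) x = qform (udiag W q) (x *m Q).
  by rewrite -NE /N qform_compress.
have c0 i : 0 <= c 0 i.
  have [_ <-] := qform_row c i Uu; rewrite qNE qform_udiag.
  by apply: sumr_ge0 => j _; rewrite mulr_ge0 ?nsq_ge0.
apply: ler_prod => i _; rewrite c0 /=.
have {}dc : nonincr c by move=> r s /dc; rewrite !mxE.
have := @courant_le _ _ _ le_kn Q U W c q 0 1 Qu Uu Wu dc dq ler01.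
move/(_ _ i); rewrite add0r mul1r; apply=> x _.
by rewrite add0r mul1r qNE.
Qed.

Lemma det_conjugate (F : numClosedFieldType) k (A : 'M[F]_k) :
  \det (A^t*) = (\det A)^*%R.
Proof. by rewrite det_map_mx det_tr. Qed.

(** Taking determinants, the factor [\det T] and its conjugate appear on both sides and cancel. This
    passes from independent rows [T *m Q] to orthonormal rows [Q]. *)
Lemma det_compress (F : numClosedFieldType) k n (L T : 'M[F]_k) (Q : 'M[F]_(k, n))
    (M : 'M[F]_n) :
  Q \is unitarymx -> \det T != 0 ->
  T *m Q *m M *m (T *m Q)^t* = L *m (T *m Q *m (T *m Q)^t*) *m L^t* ->
  \det (Q *m M *m Q^t*) = \det L * (\det L)^*%R.
Proof.
move=> Qu Tdet; rewrite trmx_mul map_mxM.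
have -> : T *m Q *m M *m (Q^t* *m T^t*) = T *m (Q *m M *m Q^t*) *m T^t*.
  by rewrite !mulmxA.
have -> : T *m Q *m (Q^t* *m T^t*) = T *m T^t*.
  by rewrite mulmxA -[T *m Q *m _]mulmxA (unitarymxP Qu) mulmx1.
move=> /(congr1 determinant); rewrite !det_mulmx !det_conjugate => eqd.
have Tc : (\det T)^*%R != 0 by rewrite conjC_eq0.
apply: (mulfI (mulf_neq0 Tdet Tc)).
by rewrite mulrAC eqd; ring.
Qed.

(* With [Y = G G E], [Y Y^* = G^2 E^2 G^2] while [Y] is similar to [G E G], so
   this is Weyl's comparison of the products of eigenvalues and of singular
   values of [Y]. *)
Lemma weyl_prod_le k n (le_kn : (k <= n)%N) (G E V W : 'M[C]_n) (p q : 'rV[R]_n) :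
  V \is unitarymx -> W \is unitarymx -> nonincr q -> (forall i, 0 <= q 0 i) ->
  G \in unitmx -> G^t* = G -> E^t* = E ->
  G *m E *m G = udiag V p -> G *m G *m (E *m E) *m (G *m G) = udiag W q ->
  (\prod_(i < k) p 0 (widen_ord le_kn i)) ^+ 2 <= \prod_(i < k) q 0 (widen_ord le_kn i).
Proof.
move=> Vu Wu dq q0 Gu Gh Eh PE ME.
pose Vk : 'M[C]_(k, n) := rowsub (widen_ord le_kn) V.
pose pk : 'rV[R]_k := \row_i p 0 (widen_ord le_kn i).
pose L : 'M[C]_k := diag_mx (map_mx (real_complex R) pk).
have VkE : Vk *m (G *m E *m G) = L *m Vk.
  rewrite PE udiag.unlock /Vk mul_rowsub_mx !mulmxA (unitarymxP Vu) mul1mx.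
  by rewrite !mul_diag_mx; apply/matrixP => i j; rewrite !mxE.
(* Since [G *m G *m E] is conjugate to [G *m E *m G] by [G], the rows of [Z] are left eigenvectors
   of the former, with the first [k] entries of [p] as eigenvalues. *)
pose Z := Vk *m invmx G.
have ZY : Z *m (G *m G *m E) = L *m Z.
  by rewrite /Z !mulmxA -VkE !mulmxA mulmxKV // mulmxK.
have ZM : Z *m udiag W q *m Z^t* = L *m (Z *m Z^t*) *m L^t*.
  rewrite -ME.
  have -> : G *m G *m (E *m E) *m (G *m G) = (G *m G *m E) *m (G *m G *m E)^t*.
    by rewrite !trmxC_mul Gh Eh !mulmxA.
  rewrite mulmxA ZY -[_ *m Z^t*]mulmxA -trmxC_mul ZY.
  by rewrite trmxC_mul !mulmxA.

have Zfree : row_free Z.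
  rewrite /row_free /Z mxrankMfree ?row_free_unit ?unitmx_inv //.
  rewrite -[X in X == _]/(\rank (rowsub _ V)) mxrank_unitary //.
  apply/unitarymxP/matrixP => i j.
  have := congr1 (fun M : 'M[C]_n => M (widen_ord le_kn i) (widen_ord le_kn j)) (unitarymxP Vu).
  rewrite !mxE => E0; rewrite -[RHS]/((widen_ord le_kn i == widen_ord le_kn j)%:R) -E0.
  by apply: eq_bigr => r _; rewrite !mxE.
(* The rows of [Z] are only independent; orthonormalizing them gives [Z = T *m Q], with [T]
   invertible by rank. *)
have Qu := schmidt_unitarymx Z le_kn.
have /submxP[T ZE] := schmidt_sub Z.
move: (schmidt Z) Qu ZE => Q Qu ZE.
have Tdet : \det T != 0.
  rewrite -unitfE -[_ \is a _]/(T \in unitmx) -row_free_unit /row_free.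
  by rewrite eqn_leq rank_leq_row -{1}(eqP Zfree) ZE mxrankM_maxl.
have [c cE le_c] := compress_det_le le_kn Qu Wu dq q0.
apply: le_trans le_c; rewrite le_eqVlt; apply/orP; left; apply/eqP/(@complexI R).
rewrite -cE.
rewrite ZE in ZM; rewrite (det_compress Qu Tdet ZM).
have -> : \det L = (\prod_(i < k) p 0 (widen_ord le_kn i))%:C.
  by rewrite det_diag rmorph_prod; apply: eq_bigr => i _; rewrite !mxE.
set x := \prod_(i < k) p _ _; have -> : ((x%:C)^*%R = x%:C :> C) by exact: conjc_real.
by rewrite rmorphXn.
Qed.

End Doubling.

(** * The Golden-Thompson log-majorization *)

Section GoldenThompson.
Variable R : realType.
Local Notation C := R[i].

(** Both bounds come from [1 + u <= e^u] and [1 - u <= e^(-u)], the second giving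
    [e^u <= 1 / (1 - u) <= 1 + 2 u] when [0 <= u <= 1/2]. *)
Lemma expRB1_le (u : R) : `|u| <= 2^-1 -> `|expR u - 1| <= 2 * `|u|.
Proof.
move=> u_small; have u2 := expR_ge1Dx u; have u3 := expR_ge1Dx (- u).
have uN : expR u * expR (- u) = 1 by rewrite expRN divff // gt_eqF ?expR_gt0.
have u1 := expR_gt0 u.
move: u_small; rewrite ler_norml => /andP[ul uu].
have [u0|/ltW u0] := leP 0 u; rewrite ?(ger0_norm u0) ?(ler0_norm u0).
  by rewrite ler_norml; apply/andP; split; nra.
by rewrite ler_norml; apply/andP; split; nra.
Qed.

(** With [v = u - 2 u^2], [e^v <= 1 / (1 - v)], while [(1 + u) (1 - v) = 1 + u^2 (1 + 2 u) >= 1]. *)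
Lemma expR_le1D (u : R) : - 2^-1 <= u -> expR (u - 2 * u ^+ 2) <= 1 + u.
Proof.
move=> u_ge; set v := u - _; have v1 := expR_ge1Dx (- v).
have vN : expR v * expR (- v) = 1 by rewrite expRN divff // gt_eqF ?expR_gt0.
have e0 := expR_gt0 v.
have : expR v * (1 - v) <= 1 by rewrite -[leRHS]vN ler_pM2l.
have v_lt : 0 < 1 - v by rewrite /v; nra.
move=> h; rewrite -(ler_pM2r v_lt); apply: le_trans h _.
have -> : (1 + u) * (1 - v) = 1 + u ^+ 2 * (1 + 2 * u) by rewrite /v; ring.
by rewrite lerDl mulr_ge0 ?sqr_ge0 //; lra.
Qed.

Lemma nsqM (x y : C) : nsq (x * y) = nsq x * nsq y.
Proof. by case: x y => a b [c d]; rewrite /nsq /=; ring. Qed.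

Lemma nsq_conj (x : C) : nsq (x^*%R) = nsq x.
Proof. by case: x => a b; rewrite /nsq /= sqrrN. Qed.

Lemma Re_le_sqrt_nsq (z : C) : `|complex.Re z| <= Num.sqrt (nsq z).
Proof. by rewrite -sqrtr_sqr ler_wsqrtr // lerDl sqr_ge0. Qed.

Lemma nsq_le_sqn k (x : 'rV[C]_k) i : nsq (x 0 i) <= sqn x.
Proof.
by rewrite /sqn (bigD1 i) //= lerDl sumr_ge0 // => j _; exact: nsq_ge0.
Qed.

Lemma qformE k (M : 'M[C]_k) x :
  qform M x = \sum_s \sum_r complex.Re (x 0 r * M r s * (x 0 s)^*%R).
Proof.
rewrite qform.unlock mxE Re_sum; apply: eq_bigr => s _.
by rewrite !mxE mulr_suml Re_sum.
Qed.

Lemma Re_realM (c : R) (z : C) : complex.Re (c%:C * z) = c * complex.Re z.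
Proof. by case: z => a b /=; rewrite mul0r subr0. Qed.

(** Coordinates of a unit vector have modulus at most [1], so rescaling changes the term of indices
    [r], [s] by at most [|g r * g s - 1|] times the modulus of [M r s]. *)
Lemma qform_rescale k (M : 'M[C]_k) (y : 'rV[C]_k) (g : 'I_k -> R) :
  sqn y = 1 -> 
  qform M y - \sum_s \sum_r `|g r * g s - 1| * Num.sqrt (nsq (M r s))
    <= qform M (\row_r ((g r)%:C * y 0 r)).
Proof.
move=> y1; rewrite !qformE lerBlDr -lerBlDl -sumrB; apply: ler_sum => s _.
rewrite -sumrB; apply: ler_sum => r _; rewrite !mxE.
set z := y 0 r * M r s * _.
have -> : (g r)%:C * y 0 r * M r s * ((g s)%:C * y 0 s)^*%R = (g r * g s)%:C * z.
  have -> : ((g s)%:C * y 0 s)^*%R = (g s)%:C * (y 0 s)^*%R :> C.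
    by apply/eqP; case: (y 0 s) => u v; rewrite eq_complex /=; apply/andP; split; apply/eqP; ring.
  have -> : (g r * g s)%:C = (g r)%:C * (g s)%:C :> C by exact: rmorphM.
  rewrite /z; move: ((y 0 s)^*%R) (g r)%:C (g s)%:C => w u v.
  by ring.
rewrite Re_realM.
have -> : complex.Re z - g r * g s * complex.Re z = - ((g r * g s - 1) * complex.Re z) by ring.
apply: le_trans (ler_norm _) _; rewrite normrN normrM ler_wpM2l //.
apply: le_trans (Re_le_sqrt_nsq _) _; apply: ler_wsqrtr.
rewrite /z !nsqM nsq_conj.
have := nsq_le_sqn y r; have := nsq_le_sqn y s; rewrite y1.
have := nsq_ge0 (y 0 r); have := nsq_ge0 (y 0 s); have := nsq_ge0 (M r s).
move: (nsq (y 0 r)) (nsq (M r s)) (nsq (y 0 s)) => m1 m2 m3 m20 m30 m10 m31 m11.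
rewrite -[leRHS]mulr1 ler_pM ?mulr_ge0 //.
by rewrite -[leRHS]mul1r ler_wpM2r.
Qed.

(** * Symmetric Trotter products *)

Definition texp (t : R) n (d : 'rV[R]_n) := map_mx (fun x => expR (t * x)) d.

(** This is [P(t)] for the matrices [udiag Ua a] and [udiag Ub b]; splitting the first exponential
    keeps it Hermitian. *)
Definition trotter n (Ua Ub : 'M[C]_n) (a b : 'rV[R]_n) (t : R) : 'M[C]_n :=
  udiag Ua (texp (t / 2) a) *m udiag Ub (texp t b) *m udiag Ua (texp (t / 2) a).

Lemma udiag_texpD n (U : 'M[C]_n) (d : 'rV[R]_n) s t : U \is unitarymx ->
  udiag U (texp s d) *m udiag U (texp t d) = udiag U (texp (s + t) d).
Proof.
move=> Uu; rewrite udiagM //; congr udiag; apply/rowP => i.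
by rewrite !mxE -expRD mulrDl.
Qed.

Lemma udiag0 n (U : 'M[C]_n) (d : 'rV[R]_n) : U \is unitarymx ->
  udiag U (texp 0 d) = 1%:M.
Proof.
move=> Uu; rewrite udiag.unlock.
have -> : diag_mx (map_mx (real_complex R) (texp 0 d)) = 1%:M.
  by apply/matrixP => i j; rewrite !mxE mul0r expR0.
by rewrite mulmx1 unitarymx_trK.
Qed.

Lemma udiag_texp_unit n (U : 'M[C]_n) (d : 'rV[R]_n) t : U \is unitarymx ->
  udiag U (texp t d) \in unitmx.
Proof.
move=> Uu; have := @udiag_texpD n U d t (- t) Uu.
by rewrite subrr (udiag0 d Uu); case/mulmx1_unit.
Qed.

Lemma trotter_herm n (Ua Ub : 'M[C]_n) a b t : (trotter Ua Ub a b t)^t* = trotter Ua Ub a b t.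
Proof. by rewrite /trotter !trmxC_mul !udiag_herm mulmxA. Qed.

Lemma trotter_hermsymmx n (Ua Ub : 'M[C]_n) a b t : trotter Ua Ub a b t \is hermsymmx.
Proof. by apply/is_hermitianmxP; rewrite scale1r trotter_herm. Qed.

Section Fixed.
Variables (n : nat) (Ua Ub : 'M[C]_n) (a b : 'rV[R]_n).
Hypotheses (Uau : Ua \is unitarymx) (Ubu : Ub \is unitarymx).

Local Notation P := (trotter Ua Ub a b).
Local Notation G t := (udiag Ua (texp (t / 2) a)).

Lemma qform_trotter t x : qform (P t) x = qform (udiag Ub (texp t b)) (x *m G t).
Proof. by rewrite -qform_compress udiag_herm. Qed.

Lemma trotter_eig_ge0 t V p : V \is unitarymx -> P t = udiag V p -> forall i, 0 <= p 0 i.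
Proof.
move=> Vu PE i; have [_ <-] := qform_row p i Vu; rewrite -PE qform_trotter qform_udiag.
by apply: sumr_ge0 => j _; rewrite mulr_ge0 ?nsq_ge0 // mxE expR_ge0.
Qed.

(** Weyl's inequality with [G = e^(ta/2)] and [E = e^(tb)]: then [G E G = P(t)] and
    [G^2 E^2 G^2 = P(2t)]. *)
Lemma trotter_prod_double k (le_kn : (k <= n)%N) t V W p q :
  V \is unitarymx -> W \is unitarymx -> nonincr q ->
  P t = udiag V p -> P (2 * t) = udiag W q ->
  (\prod_(i < k) p 0 (widen_ord le_kn i)) ^+ 2 <= \prod_(i < k) q 0 (widen_ord le_kn i).
Proof.
move=> Vu Wu dq PV PW.
apply: (weyl_prod_le le_kn (G := G t) (E := udiag Ub (texp t b)) Vu Wu dq) => //.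
- exact: trotter_eig_ge0 PW.
- exact: udiag_texp_unit.
- exact: udiag_herm.
- exact: udiag_herm.
have t2 : 2 * t / 2 = t by field.
have tt : t + t = 2 * t by ring.
by rewrite -PW /trotter !udiag_texpD // t2 -splitr tt.
Qed.

Lemma trotter_prod_iter k (le_kn : (k <= n)%N) m t V W p q :
  V \is unitarymx -> W \is unitarymx -> nonincr q ->
  P t = udiag V p -> P (2 ^+ m.+1 * t) = udiag W q ->
  (\prod_(i < k) p 0 (widen_ord le_kn i)) ^+ (2 ^ m.+1)
    <= \prod_(i < k) q 0 (widen_ord le_kn i).
Proof.
move=> Vu Wu dq; elim: m t V p Vu => [|m IH] t V p Vu PV PW.
  by rewrite expr1 in PW; apply: trotter_prod_double PV PW.
have [V' [p' [Vu' PV' dp']]] := herm_sorted id (trotter_hermsymmx Ua Ub a b (2 * t)).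
have {}dp' : nonincr p' by move=> i j /dp'; rewrite !mxE.
have PW' : P (2 ^+ m.+1 * (2 * t)) = udiag W q by rewrite mulrA -exprSr.
rewrite expnS exprM; apply: le_trans (IH _ _ _ Vu' PV' PW').
have dbl := trotter_prod_double le_kn Vu Vu' dp' PV PV'.
apply: lerXn2r dbl; rewrite nnegrE ?sqr_ge0 //.
by apply: prodr_ge0 => i _; apply: trotter_eig_ge0 PV' _.
Qed.

(** With [z = x *m G t], the bound [e^(tb) >= 1 + tb] leaves the squared norm of [z] plus [t] times
    the form of [udiag Ub b] at [z]. That norm is the form of [e^(ta)] at [x], bounded below in the
    same way; replacing [z] by [x] in the other form costs [t * S]. *)
Lemma trotter_form_ge : exists S t1 : R, [/\ 0 <= S, 0 < t1 &
  forall t x, 0 < t -> t <= t1 -> sqn x = 1 ->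
    1 + t * qform (udiag Ua a + udiag Ub b) x - t ^+ 2 * S <= qform (P t) x].
Proof.
(* [bb] is [udiag Ub b] in the eigenbasis of [udiag Ua a]. There the factors
   [exp (t (a_r + a_s) / 2)] differ from [1] by at most [t |a_r + a_s|], whence [S];
   [t <= 1 / (1 + M)] keeps the exponents within the [1/2] required by [expRB1_le]. *)
pose bb := Ua *m udiag Ub b *m Ua^t*.
pose S := \sum_s \sum_r `|a 0 r + a 0 s| * Num.sqrt (nsq (bb r s)).
pose M := \sum_s \sum_r `|a 0 r + a 0 s|.
have M0 : 0 <= M by apply: sumr_ge0 => s _; apply: sumr_ge0.
have S0 : 0 <= S.
  by apply: sumr_ge0 => s _; apply: sumr_ge0 => r _; rewrite mulr_ge0 ?sqrtr_ge0.
exists S, (1 + M)^-1; split => //; first by rewrite invr_gt0; lra.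
move=> t x t0 t_le x1.
have tM : t * (1 + M) <= 1.
  by rewrite -(@ler_pM2r _ (1 + M)^-1) ?invr_gt0 ?mulfK ?mul1r //; lra.
have le_M r s : `|a 0 r + a 0 s| <= M.
  rewrite /M (bigD1 s) //= (bigD1 r) //= -addrA lerDl addr_ge0 ?sumr_ge0 // => i _.
  exact: sumr_ge0.
rewrite qform_trotter qformD (qform_udiag Ub (texp t b)).
have w0 i : 0 <= nsq ((x *m G t *m Ub^t*) 0 i) by exact: nsq_ge0.
apply: le_trans (_ : \sum_i nsq ((x *m G t *m Ub^t*) 0 i) * (1 + t * b 0 i) <= _); last first.
  by apply: ler_sum => i _; rewrite ler_wpM2l // mxE expR_ge1Dx.
have -> : \sum_i nsq ((x *m G t *m Ub^t*) 0 i) * (1 + t * b 0 i)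
   = sqn (x *m G t) + t * qform (udiag Ub b) (x *m G t).
  rewrite qform_udiag mulr_sumr -[X in X + _](@sqn_unitary _ _ _ _ (Ub^t*)) ?trmxC_unitary //.
  by rewrite /sqn -big_split; apply: eq_bigr => i _ /=; ring.
have [wa0 wa1] := udiag_weights Uau x1.
have sqnG : 1 + t * qform (udiag Ua a) x <= sqn (x *m G t).
  have -> : sqn (x *m G t) = qform (udiag Ua (texp t a)) x.
    apply: (@complexI R); rewrite -sqnE trmxC_mul udiag_herm mulmxA -[x *m _ *m _]mulmxA.
    rewrite udiag_texpD // -splitr.
    have -> : (x *m udiag Ua (texp t a) *m x^t*) 0 0
       = (complex.Re ((x *m udiag Ua (texp t a) *m x^t*) 0 0))%:C; last by rewrite qform.unlock.
    rewrite RRe_real //; apply/CrealP.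
    rewrite -[RHS](_ : ((x *m udiag Ua (texp t a) *m x^t*)^t*) 0 0 = _); first by rewrite !mxE.
    by rewrite !trmxC_mul trmxCK udiag_herm mulmxA.
  rewrite !qform_udiag -[1 in leLHS]wa1 mulr_sumr -big_split; apply: ler_sum => i _ /=.
  rewrite mulrCA -[X in X + _]mulr1 -mulrDr ler_wpM2l // mxE; exact: expR_ge1Dx.
pose y := x *m Ua^t*.
have UaT : Ua^t* \is unitarymx by rewrite (trmxC_unitary Ua); exact: Uau.
have y1 : sqn y = 1 by rewrite /y (sqn_unitary x UaT).
have bbE z : qform (udiag Ub b) (z *m Ua) = qform bb z by rewrite -qform_compress.
have xE : x = y *m Ua by rewrite /y -mulmxA unitarymx_trK // mulmx1.
(* In its own eigenbasis [G t] acts by rescaling coordinates, the situation of [qform_rescale]. *)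
have GE : x *m G t = (\row_r ((expR (t / 2 * a 0 r))%:C * y 0 r)) *m Ua.
  rewrite udiag.unlock !mulmxA -/y; congr (_ *m _).
  by apply/rowP => i; rewrite mul_mx_diag !mxE mulrC.
have formB : qform (udiag Ub b) x - t * S <= qform (udiag Ub b) (x *m G t).
  rewrite GE bbE [in leLHS]xE bbE.
  apply: le_trans (qform_rescale _ (fun r => expR (t / 2 * a 0 r)) y1).
  rewrite lerD2l lerN2 /S mulr_sumr; apply: ler_sum => s _.
  rewrite mulr_sumr; apply: ler_sum => r _; rewrite mulrA ler_wpM2r ?sqrtr_ge0 //.
  rewrite -expRD -mulrDr.
  have absE : `|t / 2 * (a 0 r + a 0 s)| = t / 2 * `|a 0 r + a 0 s|.
    by rewrite normrM ger0_norm //; lra.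
  apply: le_trans (expRB1_le _) _; rewrite absE; last by lra.
  by have := le_M r s; nra.
by nra.
Qed.

(** Courant-Fischer turns the form bound into [1 + u <= p 0 j] with [u = t * k 0 j - t ^+ 2 * S],
    and [expR_le1D] turns [1 + u] into an exponential, ready for taking powers. *)
Lemma trotter_eig_ge V k : V \is unitarymx -> nonincr k ->
  udiag Ua a + udiag Ub b = udiag V k ->
  exists C0 t1 : R, [/\ 0 <= C0, 0 < t1 &
    forall t W p, 0 < t -> t <= t1 -> W \is unitarymx -> nonincr p ->
      P t = udiag W p -> forall j, expR (t * (k 0 j - t * C0)) <= p 0 j].
Proof.
move=> Vu dk KE; have [S [t1 [S0 t10 formP]]] := trotter_form_ge.
pose M := \sum_j `|k 0 j|.
have M0 : 0 <= M by exact: sumr_ge0.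
(* Since [|u| <= t (M + S)], the loss [2 u^2] of [expR_le1D] is at most [2 t^2 (M + S)^2]; [t2]
   ensures [u >= -1/2]. *)
pose C0 := S + 2 * (M + S) ^+ 2.
pose t2 := (2 * (1 + M + S))^-1.
have t20 : 0 < t2 by rewrite invr_gt0; lra.
exists C0, (Num.min t1 t2); split; first by rewrite addr_ge0 // mulr_ge0 ?sqr_ge0.
  by rewrite lt_min t10.
move=> t W p t0; rewrite le_min => /andP[tt1 tt2] Wu dp PE j.
have tMS : t * (2 * (1 + M + S)) <= 1.
  have Mp : 0 < 2 * (1 + M + S) by lra.
  by rewrite -(@ler_pM2r _ (2 * (1 + M + S))^-1) ?invr_gt0 // mulfK ?gt_eqF // mul1r.
have := @courant_le _ _ _ (leqnn n) 1%:M V W k p (1 - t ^+ 2 * S) t.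
have wE : widen_ord (leqnn n) j = j by apply: val_inj.
have Iu : (1%:M : 'M[C]_n) \is unitarymx.
  by apply/unitarymxP; rewrite mul1mx trmx1 map_mx1.
move=> /(_ Iu Vu Wu dk dp (ltW t0)) => cou.
have {}cou : 1 - t ^+ 2 * S + t * k 0 j <= p 0 j.
  rewrite -[in leRHS]wE; apply: cou => x x1.
  by rewrite mulmx1 -PE -KE; have := formP t x t0 tt1 x1; lra.
apply: le_trans cou.
have kM : `|k 0 j| <= M by rewrite /M (bigD1 j) //= lerDl sumr_ge0.
move: kM; rewrite ler_norml => /andP[kl ku].
pose u := t * k 0 j - t ^+ 2 * S.
have tMS' : 2 * t + 2 * (t * (M + S)) <= 1.
  by apply: le_trans tMS; rewrite le_eqVlt; apply/orP; left; apply/eqP; ring.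
have tMS0 : 0 <= t * (M + S) by rewrite mulr_ge0 ?addr_ge0 // ltW.
have t1' : 0 <= 1 - t by lra.
have ul : - (t * (M + S)) <= u.
  rewrite -subr_ge0 (_ : _ - _ = t * (k 0 j + M) + t * S * (1 - t)); last by rewrite /u; ring.
  by rewrite addr_ge0 ?mulr_ge0 //; lra.
have uu : u <= t * (M + S).
  rewrite -subr_ge0 (_ : _ - _ = t * (M - k 0 j) + t * S + t * t * S); last by rewrite /u; ring.
  by rewrite !addr_ge0 ?mulr_ge0 //; lra.
have -> : 1 - t ^+ 2 * S + t * k 0 j = 1 + u by rewrite /u; ring.
apply: le_trans (expR_le1D (u := u) _); last by lra.
rewrite ler_expR.
have usq : u ^+ 2 <= (t * (M + S)) ^+ 2.
  rewrite -real_normK ?num_real // lerXn2r ?nnegrE ?normr_ge0 ?mulr_ge0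
     ?ler_norml ?ul // ?addr_ge0 //.
  exact: ltW.
have -> : t * (k 0 j - t * C0) = u - 2 * (t * (M + S)) ^+ 2 by rewrite /u /C0; ring.
by lra.
Qed.

Lemma udiag_tr (U : 'M[C]_n) (d : 'rV[R]_n) : U \is unitarymx ->
  \tr (udiag U d) = (\sum_i d 0 i)%:C.
Proof.
move=> Uu; rewrite udiag.unlock -mulmxA mxtrace_mulC -mulmxA (unitarymxP Uu) mulmx1.
by rewrite mxtrace_diag raddf_sum; apply: eq_bigr => i _; rewrite mxE.
Qed.

(** At [t = 2^-(N+1)] the eigenvalues of [P(t)] dominate [exp (t (k_i - t C0))]. Doubling up to
    [P(1)] raises the products to the power [1/t], which leaves an error [t m C0] in the exponent
    that tends to [0]. *)
Lemma golden_thompson_prod_le V W k q m (le_mn : (m <= n)%N) :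
  V \is unitarymx -> W \is unitarymx -> nonincr k -> nonincr q ->
  udiag Ua a + udiag Ub b = udiag V k -> P 1 = udiag W q ->
  \prod_(i < m) expR (k 0 (widen_ord le_mn i)) <= \prod_(i < m) q 0 (widen_ord le_mn i).
Proof.
move=> Vu Wu dk dq KE PE; have [C0 [t1 [C00 t10 eig]]] := trotter_eig_ge Vu dk KE.
rewrite -expR_sum; set s := \sum_i _; set Q := \prod_i _.
have key N : 2 ^- N.+1 <= t1 -> expR (s - 2 ^- N.+1 * (m%:R * C0)) <= Q.
  move=> Nt1; pose t : R := 2 ^- N.+1.
  have t0 : 0 < t by rewrite invr_gt0 exprn_gt0.
  have [V' [p' [Vu' PV' dp']]] := herm_sorted id (trotter_hermsymmx Ua Ub a b t).
  have {}dp' : nonincr p' by move=> i j /dp'; rewrite !mxE.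
  have PE' : P (2 ^+ N.+1 * t) = udiag W q.
    by rewrite /t mulfV // expf_neq0 // pnatr_eq0.
  apply: le_trans (trotter_prod_iter le_mn Vu' Wu dq PV' PE').
  have -> : expR (s - t * (m%:R * C0)) =
     (\prod_(i < m) expR (t * (k 0 (widen_ord le_mn i) - t * C0))) ^+ (2 ^ N.+1).
    rewrite -expR_sum -expRM_natl; congr expR.
    have -> : (2 ^ N.+1)%:R = t^-1 :> R by rewrite /t invrK natrX.
    rewrite -mulr_sumr mulKf ?gt_eqF // sumrB sumr_const card_ord -/s -mulr_natl; ring.
  apply: lerXn2r; rewrite ?nnegrE.
  - by apply: prodr_ge0 => i _; exact: expR_ge0.
  - by apply: prodr_ge0 => i _; apply: trotter_eig_ge0 PV' _.
  - by apply: ler_prod => i _; rewrite expR_ge0 /=; apply: eig dp' PV' _.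
have small e : 0 < e -> exists N, 2 ^- N.+1 <= e :> R.
  move=> e0; exists (Num.bound e^-1).
  rewrite -[leRHS]invrK lef_pV2 ?posrE ?exprn_gt0 ?invr_gt0 //.
  have e1 : 0 <= e^-1 by rewrite invr_ge0 ltW.
  apply: le_trans (ltW (archi_boundP e1)) _; rewrite -natrX ler_nat.
  by apply: leq_trans (ltnW (ltn_expl _ (ltnSn 1))) _; rewrite leq_exp2l.
have Q0 : 0 < Q by have [N /key] := small _ t10; apply: lt_le_trans; exact: expR_gt0.
rewrite -[Q]lnK ?posrE // ler_expR leNgt; apply/negP => lt_Qs.
(* If the bound failed by [D > 0] on the logarithmic scale, a step [t] below [D / (2 (1 + m C0))]
   would make the error smaller than [D]. *)
pose D := s - ln Q; have D0 : 0 < D by rewrite subr_gt0.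
have mC : 0 <= m%:R * C0 by rewrite mulr_ge0.
have e0 : 0 < Num.min t1 (D / (2 * (1 + m%:R * C0))).
  by rewrite lt_min t10 divr_gt0 //; lra.
have [N] := small _ e0; rewrite le_min => /andP[/key Nk].
rewrite ler_pdivlMr; last by lra.
move: Nk; rewrite -{1}[Q]lnK ?posrE // ler_expR.
have : 0 < 2 ^- N.+1 :> R by rewrite invr_gt0 exprn_gt0.
by rewrite /D in D0 *; nra.
Qed.

(** Both products are the exponential of the sum of the traces: the determinant is multiplicative
    and the trace additive. *)
Lemma golden_thompson_det V W k q :
  V \is unitarymx -> W \is unitarymx ->
  udiag Ua a + udiag Ub b = udiag V k -> P 1 = udiag W q ->
  \prod_i q 0 i = \prod_i expR (k 0 i).
Proof.
move=> Vu Wu KE PE; rewrite -expR_sum.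
have <- : \sum_i a 0 i + \sum_i b 0 i = \sum_i k 0 i.
  have := congr1 mxtrace KE; rewrite mxtraceD (udiag_tr a Uau) (udiag_tr b Ubu) (udiag_tr k Vu) => E.
  by apply: (@complexI R); rewrite -E; exact: rmorphD.
apply: (@complexI R); rewrite -(det_udiag q Wu) -PE /trotter !det_mulmx !det_udiag //.
rewrite -!rmorphM; congr (_%:C).
have tE s d : \prod_(i < n) texp s d 0 i = expR (s * \sum_i d 0 i).
  by rewrite mulr_sumr expR_sum; apply: eq_bigr => i _; rewrite mxE.
by rewrite !tE -!expRD; congr expR; field.
Qed.

End Fixed.
End GoldenThompson.

(** * Horn's theorem *)

Section Horn.
Variable R : realType.
Local Notation C := R[i].

(** The direct sum of the 2 by 2 matrix with rows [p, q] and [u, v] with [E]. The nesting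
    [1 + (1 + k)] lets the first coordinate be split off alone. *)
Definition corner_block (F : comNzRingType) k (p q u v : F) (E : 'M[F]_k) : 'M[F]_(1 + (1 + k)) :=
  block_mx p%:M (row_mx q%:M 0) (col_mx u%:M 0) (block_mx v%:M 0 0 E).

Lemma corner_blockM (F : comNzRingType) k (p q u v p' q' u' v' : F) (E E' : 'M[F]_k) :
  corner_block p q u v E *m corner_block p' q' u' v' E' =
  corner_block (p * p' + q * u') (p * q' + q * v') (u * p' + v * u') (u * q' + v * v') (E *m E').
Proof.
rewrite /corner_block mulmx_block; congr block_mx.
- by rewrite mul_row_col mulmx0 addr0 -!scalar_mxM -raddfD.
- rewrite mul_row_block mul_mx_row !mulmx0 mul0mx !addr0 add_row_mx addr0.
  by rewrite -!scalar_mxM -raddfD.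
- rewrite mul_block_col mul_col_mx !mul0mx mulmx0 !addr0 add_col_mx addr0.
  by rewrite -!scalar_mxM -raddfD.
- rewrite mulmx_block mul_col_row !mulmx0 !mul0mx !addr0 add0r add_block_mx.
  by rewrite !addr0 add0r -!scalar_mxM -raddfD.
Qed.

Lemma corner_block1 (F : comNzRingType) k : corner_block 1 0 0 1 (1%:M : 'M[F]_k) = 1%:M.
Proof.
rewrite /corner_block !raddf0 row_mx0 col_mx0.
by rewrite -(scalar_mx_block 1 k) -scalar_mx_block.
Qed.

Lemma corner_block_trC (F : numClosedFieldType) k (p q u v : F) :
  (corner_block p q u v (1%:M : 'M[F]_k))^t*
  = corner_block p^*%R u^*%R q^*%R v^*%R 1%:M.
Proof.
rewrite /corner_block tr_block_mx tr_row_mx tr_col_mx tr_block_mx.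
rewrite map_block_mx map_row_mx map_col_mx map_block_mx.
by rewrite !trmx0 !tr_scalar_mx !map_scalar_mx !map_mx0 /= conjC1.
Qed.

Lemma corner_block_unitary k (x y : R) : x ^+ 2 + y ^+ 2 = 1 ->
  corner_block x%:C y%:C (- y)%:C x%:C (1%:M : 'M[C]_k) \is unitarymx.
Proof.
move=> xy; apply/unitarymxP.
have cE (z : R) : (z%:C)^*%R = z%:C :> C by exact: conjc_real.
rewrite corner_block_trC !cE corner_blockM mulmx1.
rewrite -!rmorphM -!rmorphD /=.
have -> : x * x + y * y = 1 by rewrite -!expr2.
have -> : - y * - y + x * x = 1 by rewrite mulrNN addrC -!expr2.
have -> : x * - y + y * x = 0 by ring.
have -> : - y * x + x * y = 0 by ring.
exact: corner_block1.
Qed.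

(** [l ^+ 2] is a convex combination of [a ^+ 2] and [b ^+ 2]; the square roots of the two weights
    are [x] and [y]. For [a = b] the weight is [0/0], and [l = a]. *)
Lemma rotation_triang (a b l : R) : 0 < b -> b <= l -> l <= a ->
  exists x y : R, x ^+ 2 + y ^+ 2 = 1 /\ (x * a) ^+ 2 + (y * b) ^+ 2 = l ^+ 2.
Proof.
move=> b0 bl la; have [ab|ab] := eqVneq a b.
  exists 1, 0; split; first by ring.
  have -> : l = a by apply/eqP; rewrite eq_le la ab bl.
  by ring.
have d0 : 0 < a ^+ 2 - b ^+ 2.
  have ba : b < a by rewrite lt_neqAle eq_sym ab (le_trans bl la).
  by rewrite subr_gt0; nra.
pose w := (l ^+ 2 - b ^+ 2) / (a ^+ 2 - b ^+ 2).
have l0 : 0 < l by apply: lt_le_trans bl.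
have w0 : 0 <= w by rewrite divr_ge0 ?(ltW d0) // subr_ge0; nra.
have w1 : w <= 1 by rewrite ler_pdivrMr // mul1r; nra.
exists (Num.sqrt w), (Num.sqrt (1 - w)); rewrite !exprMn !sqr_sqrtr ?subr_ge0 //.
split; first by ring.
have -> : w * a ^+ 2 + (1 - w) * b ^+ 2 = w * (a ^+ 2 - b ^+ 2) + b ^+ 2 by ring.
by rewrite /w divfK ?gt_eqF // subrK.
Qed.

(* Up to unitary similarity, the products [diag(s) W] are the matrices with
   singular values [s]. *)
Definition achievable n (s l : seq R) : Prop :=
  exists2 W : 'M[C]_n, W \is unitarymx &
    char_poly (diag_mx (\row_(i < n) (s`_i)%:C) *m W) = \prod_(x <- l) ('X - (x%:C)%:P).

(** Conjugation by a permutation matrix reorders the diagonal and preserves the characteristic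
    polynomial. *)
Lemma achievable_perm n s s' l : size s = n -> perm_eq s s' ->
  achievable n s l -> achievable n s' l.
Proof.
move=> szs ss' [W Wu Wl].
have szs' : size s' = n by rewrite -(perm_size ss').
have /tuple_permP[p pE] : perm_eq (Tuple (introT eqP szs')) (Tuple (introT eqP szs)).
  by rewrite perm_sym.
have s'E (i : 'I_n) : s'`_i = s`_(p i).
  have := congr1 (fun r => r`_i) pE; rewrite /= => ->.
  by rewrite (nth_map i) ?size_enum_ord // nth_ord_enum (tnth_nth 0).
pose Q : 'M[C]_n := row_perm p 1%:M.
have Qu : Q \is unitarymx.
  by apply: row_perm_unitary; apply/unitarymxP; rewrite mul1mx trmx1 map_mx1.
have DE : diag_mx (\row_(i < n) (s'`_i)%:C) *m Q = Q *m diag_mx (\row_(i < n) (s`_i)%:C).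
  apply/matrixP => i j; rewrite mul_diag_mx mul_mx_diag !mxE s'E.
  by have [<-|_] := eqVneq (p i) j; rewrite ?mulr1 ?mul1r ?mulr0 ?mul0r.
exists (Q *m W *m Q^t*).
  by apply: (mul_unitarymx (mul_unitarymx Qu Wu)); rewrite (trmxC_unitary Q); exact: Qu.
rewrite !mulmxA DE -(mulmxA Q) char_poly_conj //; exact/unitarymxP.
Qed.

Lemma char_poly_lblock (F : comNzRingType) m n (A : 'M[F]_m) (B : 'M[F]_(n, m)) (D : 'M[F]_n) :
  char_poly (block_mx A 0 B D) = char_poly A * char_poly D.
Proof.
rewrite /char_poly /char_poly_mx map_block_mx map_mx0 (scalar_mx_block m n).
by rewrite opp_block_mx add_block_mx oppr0 !addr0 add0r det_lblock.
Qed.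

Lemma diag_corner_block k (a b : R) (t : seq R) :
  diag_mx (\row_(i < k.+2) ([:: a, b & t]`_i)%:C) =
  corner_block a%:C 0 0 b%:C (diag_mx (\row_(i < k) (t`_i)%:C)).
Proof.
rewrite /corner_block !raddf0 row_mx0 col_mx0.
apply/(@matrixP C (1 + (1 + k)) (1 + (1 + k))) => i j.
case: (@split_ordP 1 (1 + k) i) => {}i ->; case: (@split_ordP 1 (1 + k) j) => {}j ->.
- by rewrite block_mxEul !mxE !ord1 !eqxx.
- by rewrite block_mxEur !mxE -val_eqE /= ?ord1.

- by rewrite block_mxEdl !mxE -val_eqE /= ?ord1.

rewrite block_mxEdr; case: (@split_ordP 1 k i) => {}i ->; case: (@split_ordP 1 k j) => {}j ->.
- by rewrite block_mxEul !mxE !ord1 !eqxx.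
- by rewrite block_mxEur !mxE -val_eqE /= ?ord1.

- by rewrite block_mxEdl !mxE -val_eqE /= ?ord1.

- by rewrite block_mxEdr !mxE -val_eqE /= ?ord1.

Qed.

(* Two rotations make [diag(a, b)] triangular with diagonal [(l, a b / l)]. *)
Lemma achievable_step k (a b l : R) (t r : seq R) :
  0 < b -> b <= l -> l <= a ->
  achievable k.+1 (a * b / l :: t) r -> achievable k.+2 [:: a, b & t] (l :: r).
Proof.
move=> b0 bl la [W Wu Wr]; have [x [y [xy xyl]]] := rotation_triang b0 bl la.
have l0 : 0 < l by apply: lt_le_trans bl.
have ln0 : l != 0 by rewrite gt_eqF.
(* After the first rotation the top row of the corner is [(x a, y b)], of norm [l]. The second
   rotation has the normalized row as first column, giving entry [l] followed by [0]; the
   determinant then leaves [a b / l]. *)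
pose x' := x * a / l; pose y' := y * b / l.
have xy' : x' ^+ 2 + (- y') ^+ 2 = 1.
  rewrite sqrrN /x' /y' !exprMn -mulrDl -!exprMn xyl exprVn divff //.
  by rewrite expf_neq0.
pose Q1 : 'M[C]_(1 + (1 + k)) := corner_block x%:C y%:C (- y)%:C x%:C 1%:M.
pose Q2 : 'M[C]_(1 + (1 + k)) := corner_block x'%:C (- y')%:C (- - y')%:C x'%:C 1%:M.
pose W1 : 'M[C]_(1 + (1 + k)) := block_mx 1%:M 0 0 W.
have Q1u : Q1 \is unitarymx by apply: corner_block_unitary.
have Q2u : Q2 \is unitarymx by apply: corner_block_unitary.
have W1u : W1 \is unitarymx.
  apply/unitarymxP; rewrite /W1 tr_block_mx map_block_mx !trmx0 !map_mx0 trmx1 map_mx1.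
  rewrite mulmx_block !mulmx0 !mul0mx !addr0 add0r mulmx1 (unitarymxP Wu).
  by rewrite -scalar_mx_block.
pose D : 'M[C]_(1 + (1 + k)) := diag_mx (\row_(i < k.+2) ([:: a, b & t]`_i)%:C).
pose c := (- y * a) * x' + (x * b) * y'.
have QDQ : Q1 *m D *m Q2 = block_mx (l%:C)%:M 0 (col_mx (c%:C)%:M 0)
    (diag_mx (\row_(i < k.+1) ((a * b / l :: t)`_i)%:C) : 'M[C]_(1 + k)).
  rewrite /D diag_corner_block !corner_blockM mulmx1 mul1mx.
  rewrite !(mulr0, addr0, add0r) -!rmorphM -!rmorphD.
  have -> : x * a * x' + y * b * - - y' = l.
    rewrite opprK /x' /y' !mulrA -mulrDl.
    have -> : x * a * x * a + y * b * y * b = l ^+ 2 by rewrite -xyl; ring.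
    by rewrite expr2 mulfK.
  have -> : x * a * - y' + y * b * x' = 0 by rewrite /x' /y'; ring.
  have -> : - y * a * - y' + x * b * x' = a * b / l.
    rewrite -[RHS]mulr1 -xy /x' /y'; ring.
  rewrite /corner_block opprK -/c raddf0 row_mx0; congr block_mx.
  apply/(@matrixP C (1 + k) (1 + k)) => i j.
  case: (@split_ordP 1 k i) => {}i ->; case: (@split_ordP 1 k j) => {}j ->.
  - by rewrite block_mxEul !mxE !ord1 !eqxx.
  - by rewrite block_mxEur !mxE -val_eqE /= ?ord1.
  - by rewrite block_mxEdl !mxE -val_eqE /= ?ord1.
  - by rewrite block_mxEdr !mxE -val_eqE /= ?ord1.
(* Conjugating by [Q1] brings the product to [Q1 *m D *m Q2 *m W1], block lower triangular with
   blocks [l] and the smaller product. *)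
exists (Q2 *m W1 *m Q1); first exact: (mul_unitarymx (mul_unitarymx Q2u W1u) Q1u).
rewrite -/D -(char_poly_conj (D *m _) (unitarymxP Q1u)).
have -> : Q1 *m (D *m (Q2 *m W1 *m Q1)) *m Q1^t* = (Q1 *m D *m Q2) *m W1.
  clear - Q1u; clearbody Q1 Q2 D W1.
  by rewrite -!mulmxA (unitarymxP Q1u) mulmx1.
rewrite QDQ mulmx_block !mulmx0 !mul0mx !addr0 add0r !mulmx1 char_poly_lblock Wr big_cons.
congr (_ * _); rewrite char_poly_trig; first by rewrite big_ord1 mxE.
exact: scalar_mx_is_trig.
Qed.

(** The split occurs at the first entry of [t] not exceeding [l]. Adjacency matters in [horn]: one
    value between [a] and [b] can replace them without breaking the order. *)
Lemma split_adjacent (c l : R) (t : seq R) : l <= c -> t != [::] -> last c t <= l ->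
  exists s1 a b s2, [/\ c :: t = s1 ++ [:: a, b & s2], l <= a & b <= l].
Proof.
elim: t c => // b t IH c lc _ /= lt_l.
have [bl|/ltW lb] := leP b l; first by exists [::], c, b, t.
case: t IH lt_l => [|b' t] IH lt_l.
  by exists [::], c, b, [::].
have [s1 [a [b'' [s2 [-> la bl]]]]] := IH b lb isT lt_l.
by exists (c :: s1), a, b'', s2.
Qed.

Lemma prod_le_exp (l : R) (r : seq R) : all (fun x => 0 < x) r -> all (fun x => x <= l) r ->
  \prod_(x <- r) x <= l ^+ size r.
Proof.
elim: r => [|x r IH] /=; first by rewrite big_nil.
move=> /andP[x0 r0] /andP[xl rl]; rewrite big_cons exprS ler_pM ?IH // ltW //.
by rewrite big_seq prodr_gt0 // => y yr; exact: (allP r0).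
Qed.

Lemma prod_ge_exp (l : R) (r : seq R) : 0 <= l -> all (fun x => l <= x) r ->
  l ^+ size r <= \prod_(x <- r) x.
Proof.
move=> l0; elim: r => [|x r IH] /=; first by rewrite big_nil.
by move=> /andP[xl rl]; rewrite big_cons exprS ler_pM ?IH // exprn_ge0.
Qed.

Lemma prod_seq_gt0 (r : seq R) : all (fun x => 0 < x) r -> 0 < \prod_(x <- r) x.
Proof. by move=> r0; rewrite big_seq prodr_gt0 // => y yr; exact: (allP r0). Qed.

(** Induction: the largest target [l] is realized from adjacent [a >= l >= b] by [achievable_step],
    which replaces them by [v = a b / l]. As [b <= v <= a], the new list is sorted, and it still
    log-majorizes the remaining targets. *)
Lemma horn n (s l : seq R) : size s = n -> size l = n ->
  all (fun x => 0 < x) s -> all (fun x => 0 < x) l ->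
  sorted >=%R s -> sorted >=%R l ->
  (forall k, \prod_(x <- take k l) x <= \prod_(x <- take k s) x) ->
  \prod_(x <- l) x = \prod_(x <- s) x ->
  achievable n s l.
Proof.
have ge_trans : transitive (>=%R : rel R) by move=> ? ? ? ab bc; exact: le_trans bc ab.
elim: n s l => [|n IH] s l.
  move=> /size0nil -> /size0nil -> *; exists 1%:M.
    by apply/unitarymxP; rewrite mul1mx trmx1 map_mx1.
  by rewrite big_nil /char_poly det_mx00.
case: l => // l r szs [szr] s0 /= /andP[l0 r0] ss sl dom eqp.
(* A single value is treated apart, since the step consumes two; equality of the products determines
   it. *)
case: n IH szs szr => [|n] IH szs szr.
  case: s szs s0 ss dom eqp => [//|c [|//]] _ _ _ _.
  rewrite (size0nil szr) !big_cons !big_nil !mulr1 => ->.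
  exists 1%:M; first by apply/unitarymxP; rewrite mul1mx trmx1 map_mx1.
  by rewrite mulmx1 char_poly_trig ?diag_mx_is_trig // !big_ord1 big_seq1 !mxE.
have lr : all (fun x => x <= l) r by exact: order_path_min sl.
have sr : sorted >=%R r by exact: path_sorted sl.
have [c [t sE]] : exists c t, s = c :: t by case: s szs {s0 ss dom eqp} => // c t _; exists c, t.
have szt : size t = n.+1 by move: szs; rewrite sE => -[].
have t_neq0 : t != [::] by rewrite -size_eq0 szt.
have lc : l <= c.
  by have := dom 1%N; rewrite sE /= !take0 !big_seq1.
(* Equal full products together with the prefix inequality omitting the last entries reverse the
   comparison on those entries, so the last entry of [s] is at most the last target, hence at most
   [l]. *)
have last_le : last c t <= l.
  have r_neq0 : r != [::] by rewrite -size_eq0 szr.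
  have last_r : last l r <= l.
    by case: (r) r_neq0 lr => // y r' _ /allP; apply; exact: (mem_last y r').
  apply: le_trans last_r.
  have := dom n.+1; rewrite sE.
  have := eqp; rewrite sE [l :: r]lastI [c :: t]lastI -!cats1 !big_cat !big_seq1.
  rewrite !take_cat !size_belast szr szt ltnn subnn /= !cats0 => eqp' dom'.
  have p0 : 0 < \prod_(x <- belast l r) x.
    apply: prod_seq_gt0; apply/allP => x /mem_belast; rewrite inE => /orP[/eqP -> //|].
    by apply: (allP r0).
  have q0 : 0 < \prod_(x <- belast c t) x by apply: lt_le_trans dom'.
  have ll0 : 0 < last l r.
    have := mem_last l r; rewrite inE => /orP[/eqP -> //|]; exact: (allP r0).
  rewrite -(ler_pM2l q0) /= -eqp'; apply: ler_wpM2r dom'; exact: ltW.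
have [s1 [a [b [s2 [sE' la bl]]]]] := split_adjacent lc t_neq0 last_le.
rewrite -sE in sE'; move: (sE') => {}sE; clear sE'; subst s.
have [s10 a0 b0 s20] : [/\ all (fun x => 0 < x) s1, 0 < a, 0 < b & all (fun x => 0 < x) s2].
  by move: s0; rewrite all_cat /= => /and4P[].
move: ss; rewrite sorted_pairwise // pairwise_cat /= allrel_consr allrel_consr.
move=> /and3P[/and3P[s1a s1b s12] ps1 /and3P[/andP[ab as2] bs2 ps2]].
pose v := a * b / l.
have v0 : 0 < v by rewrite divr_gt0 ?mulr_gt0.
have lv : l * v = a * b by rewrite /v mulrC divfK // gt_eqF.
have va : v <= a by rewrite ler_pdivrMr // ler_pM2l.
have bv : b <= v by rewrite ler_pdivlMr // mulrC ler_pM2r.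
have szr' : size (s1 ++ v :: s2) = n.+1.
  by move: szs; rewrite !size_cat /= addnS => -[->].
apply: (@achievable_perm _ [:: a, b & s1 ++ s2]).
- by rewrite /= size_cat; move: szs; rewrite size_cat /= !addnS.
- by rewrite perm_sym -(cat1s a) -(cat1s b) perm_catCA perm_cat2l perm_catCA.
apply: achievable_step => //; rewrite -/v.
apply: (@achievable_perm _ (s1 ++ v :: s2)) => //.
  by rewrite -(cat1s v) perm_catCA.
apply: IH => //.
- by rewrite all_cat s10 /= v0.
- rewrite sorted_pairwise // pairwise_cat /= allrel_consr ps1 ps2 s12 !andbT.
  apply/andP; split.
    by apply/allP => x /(allP s1a) /= ; apply: le_trans.
  by apply/allP => x /(allP bs2) /= xb; apply: le_trans bv.
(* For prefixes inside [s1], [l] to the power [k] separates the products: targets are at most [l],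
   entries of [s1] at least [a >= l]. *)
- move=> k; have [ks1|s1k] := leqP k (size s1).
    rewrite takel_cat //.
    apply: le_trans (prod_le_exp (l := l) _ _) _.
    - by apply/allP => x /mem_take; apply: (allP r0).
    - by apply/allP => x /mem_take; apply: (allP lr).
    rewrite size_takel; last by rewrite szr -szr' size_cat (leq_trans ks1) ?leq_addr.
    rewrite -[X in l ^+ X](size_takel ks1); apply: prod_ge_exp; first exact: ltW.
    by apply/allP => x /mem_take /(allP s1a) /=; apply: le_trans.
  (* A longer prefix contains [v]; its inequality is the old one of length [k.+1] divided by [l],
     because [l * v = a * b]. *)
  have [m kE] : exists m, k = (size s1 + m.+1)%N.
    by exists (k - (size s1).+1)%N; rewrite addnS -addSn subnKC.
  have takeE (u : seq R) j : take (size s1 + j) (s1 ++ u) = s1 ++ take j u.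
    by rewrite take_cat ltnNge leq_addr /= addKn.
  have := dom k.+1; rewrite kE -addnS (takeE (v :: s2)) (takeE [:: a, b & s2]) /=.
  rewrite !big_cat !big_cons /= => dom'.
  rewrite addnS /= big_cons in dom'.
  rewrite -(ler_pM2l l0); apply: le_trans dom' _.
  move: (\prod_(i <- s1) i) (\prod_(j <- take m s2) j) lv => X Y lv'.
  have -> : l * (X * (v * Y)) = X * (l * v * Y) by ring.
  by rewrite lv' !mulrA.
apply: (mulfI (lt0r_neq0 l0)); move: eqp; rewrite !big_cat !big_cons /= => ->.
move: (\prod_(i <- s1) i) (\prod_(j <- s2) j) lv => X Y lv'.
have -> : l * (X * (v * Y)) = X * (l * v * Y) by ring.
by rewrite lv' !mulrA.
Qed.

End Horn.

(** * The unitary factor *)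

Lemma char_poly_conj_cancel (F : numClosedFieldType) n (W D Z : 'M[F]_n) :
  W \is unitarymx -> char_poly (W^t* *m D *m W *m (W^t* *m Z *m W)) = char_poly (D *m Z).
Proof.
move=> Wu; rewrite !mulmxA mulmxtVK // -(mulmxA _ D Z).
exact: char_poly_conj (mulmx1C (unitarymxP Wu)).
Qed.

Lemma scale_conjugate (F : comNzRingType) n (c : F) (W D Z : 'M[F]_n) :
  c *: (W *m D *m Z) = W *m (c *: D) *m Z.
Proof. by rewrite scalemxAl scalemxAr. Qed.

Section Assembly.
Variable R : realType.
Local Notation C := R[i].

Lemma take_map_enum n k (le_kn : (k <= n)%N) (d : 'rV[R]_n) :
  take k [seq d 0 i | i <- enum 'I_n] = [seq d 0 (widen_ord le_kn i) | i <- enum 'I_k].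
Proof.
have szE m (F : 'I_m -> R) : size [seq F i | i <- enum 'I_m] = m.
  by rewrite size_map size_enum_ord.
apply: (@eq_from_nth _ 0) => [|i]; rewrite size_takel ?szE // => ik.
rewrite nth_take // (nth_map (Ordinal ik)) ?size_enum_ord //.
rewrite (nth_map (Ordinal (leq_trans ik le_kn))) ?size_enum_ord ?(leq_trans ik) //.
by congr (d 0 _); apply: val_inj; rewrite /= !nth_enum_ord ?(leq_trans ik).
Qed.

Lemma prod_map_enum m (F : 'I_m -> R) :
  \prod_(x <- [seq F i | i <- enum 'I_m]) x = \prod_i F i.
Proof. by rewrite big_map big_enum. Qed.

(** The Golden-Thompson inequalities on prefixes and the equality of determinants are the hypotheses
    of [horn]. The unitary found there is conjugated by the eigenbasis [W] of [P(1)]. *)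
Lemma trotter_unitary n (Ua Ub V : 'M[C]_n) (a b k : 'rV[R]_n) :
  Ua \is unitarymx -> Ub \is unitarymx -> V \is unitarymx -> nonincr k ->
  udiag Ua a + udiag Ub b = udiag V k ->
  exists2 U : 'M[C]_n, U \is unitarymx &
    char_poly (trotter Ua Ub a b 1 *m U)
      = \prod_i ('X - ((map_mx expR k 0 i)%:C)%:P).
Proof.
move=> Uau Ubu Vu dk KE.
have [W [q [Wu PE dq]]] := herm_sorted id (trotter_hermsymmx Ua Ub a b 1).
have {}dq : nonincr q by move=> i j /dq; rewrite !mxE.
pose e := map_mx expR k.
have de : nonincr e by move=> i j ij; rewrite !mxE ler_expR dk.
have detE : \prod_i q 0 i = \prod_i e 0 i.
  rewrite (golden_thompson_det Uau Ubu Vu Wu KE PE).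
  by apply: eq_bigr => i _; rewrite mxE.
have e0 i : 0 < e 0 i by rewrite mxE expR_gt0.
(* The [q 0 i] are nonnegative, and their product equals that of the positive [e 0 i]. *)
have q0 i : 0 < q 0 i.
  rewrite lt_def (trotter_eig_ge0 Wu PE) andbT.
  have : \prod_i q 0 i != 0 by rewrite detE gt_eqF // prodr_gt0.
  by move/prodf_neq0; apply.
have [||||||k'||Z Zu ZE] := @horn R n [seq q 0 i | i <- enum 'I_n] [seq e 0 i | i <- enum 'I_n].
- by rewrite size_map size_enum_ord.
- by rewrite size_map size_enum_ord.
- by apply/allP => _ /mapP[i _ ->].
- by apply/allP => _ /mapP[i _ ->].
- exact: nonincr_sorted.
- exact: nonincr_sorted.
- have [le_kn|/ltnW lt_nk] := leqP k' n.
    rewrite !(take_map_enum le_kn) !prod_map_enum.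
    apply: le_trans (golden_thompson_prod_le Uau Ubu le_kn Vu Wu dk dq KE PE).
    by apply: ler_prod => i _; rewrite ltW //= mxE.
  (* Beyond length [n] both prefixes are the full lists, whose products agree. *)
  have szn (F : 'I_n -> R) : (size [seq F i | i <- enum 'I_n] <= k')%N.
    by rewrite size_map size_enum_ord.
  rewrite !(take_oversize (szn _)).
  by rewrite !prod_map_enum detE.
- by rewrite !prod_map_enum detE.
have WTu : W^t* \is unitarymx by rewrite (trmxC_unitary W); exact: Wu.
exists (W^t* *m Z *m W); first exact: (mul_unitarymx (mul_unitarymx WTu Zu) Wu).
rewrite PE udiag.unlock char_poly_conj_cancel //.
have <- : \row_(i < n) ([seq q 0 i | i <- enum 'I_n]`_i)%:C = map_mx (real_complex R) q.
  apply/rowP => i; rewrite !mxE (nth_map i) ?size_enum_ord //.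
  by congr ((q 0 _)%:C); apply: val_inj; rewrite /= nth_enum_ord.
by rewrite ZE big_map big_enum.
Qed.

Lemma spectrum_udiag n (I : interval R) (U : 'M[C]_n) (d : 'rV[R]_n) :
  U \is unitarymx -> spectrum_in (udiag U d) I -> forall i, d 0 i \in I.
Proof.
move=> Uu dI i; have [|x xI /complexI -> //] := dI (d 0 i)%:C.
rewrite eigenvalue_root_char (char_poly_udiag d Uu).
by rewrite (bigD1 i) //= rootM root_XsubC eqxx.
Qed.

Lemma udiagZ n (U : 'M[C]_n) (d : 'rV[R]_n) (c : R) :
  c%:C *: udiag U d = udiag U (c *: d).
Proof.
rewrite udiag.unlock scale_conjugate.
have -> // : c%:C *: diag_mx (map_mx (real_complex R) d)
    = diag_mx (map_mx (real_complex R) (c *: d)).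
by apply/matrixP => i j; rewrite !mxE rmorphM mulrnAr.
Qed.

Lemma udiagN n (U : 'M[C]_n) (d : 'rV[R]_n) : udiag U (- d) = - udiag U d.
Proof. by rewrite -scaleN1r -udiagZ rmorphN1 scaleN1r. Qed.

Lemma herm_combination n (A B : 'M[C]_n) (c c' : R) :
  A \is hermsymmx -> B \is hermsymmx -> c%:C *: A + c'%:C *: B \is hermsymmx.
Proof.
move=> /herm_udiag -> /herm_udiag ->; rewrite !udiagZ.
apply/is_hermitianmxP; rewrite scale1r.
by rewrite linearD /= map_mxD !udiag_herm.
Qed.

Lemma monotone_on_ln (I : interval R) (f : R -> R) :
  (forall x, x \in I -> 0 < f x) -> monotone_on I f -> monotone_on I (fun x => ln (f x)).
Proof.
move=> f0 [fm|fm]; [left|right] => x y xI yI xy.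
  by rewrite ler_ln ?posrE ?f0 //; exact: fm.
by rewrite ler_ln ?posrE ?f0 //; exact: fm.
Qed.

(** [f(x)^p = exp (p ln f(x))]. Writing [p = s * c] separates the Trotter time [s] from the
    coefficient [c] in [K], so that [alpha / 2] becomes the half step of [P(1)]. *)
Lemma hermpow_hermfun (I : interval R) (f : R -> R) n (U : 'M[C]_n) (d : 'rV[R]_n) (c s p : R) :
  (forall x, x \in I -> 0 < f x) -> U \is unitarymx -> (forall i, d 0 i \in I) ->
  s * c = p ->
  hermpow (hermfun f (udiag U d)) p
    = udiag U (texp s (c *: map_mx (fun x => ln (f x)) d)).
Proof.
move=> f0 Uu dI <-; rewrite /hermpow !hermfunE //; congr udiag.
apply/rowP => i; rewrite !mxE /powR gt_eqF ?f0 //.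
by rewrite mulrA.
Qed.

End Assembly.

(** * The log-convex and log-concave eigenvalue inequalities *)

Unset Implicit Arguments.

Theorem proposition3p4 (R : realType) (n : nat) (I : interval R) (f : R -> R)
    (alpha : R) (A B : 'M[R[i]]_n)
    (f_gt0 : forall x : R, x \in I -> 0 < f x)
    (f_mono : monotone_on I f)
    (alpha01 : 0 <= alpha <= 1)
    (A_herm : A \is hermsymmx) (B_herm : B \is hermsymmx)
    (A_spec : spectrum_in A I) (B_spec : spectrum_in B I) :
  (log_convex_on I f ->
     exists U : 'M[R[i]]_n,
       let X := hermpow (hermfun f A) (alpha / 2)
                *m hermpow (hermfun f B) (1 - alpha)
                *m hermpow (hermfun f A) (alpha / 2) *m U in
       [/\ U \is unitarymx, real_eigenvalues X &
           le_vec (lambda_down (hermfun f (alpha%:C *: A + (1 - alpha)%:C *: B)))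
                  (lambda_down X)])
  /\
  (log_concave_on I f ->
     exists U : 'M[R[i]]_n,
       let X := hermpow (hermfun f A) (alpha / 2)
                *m hermpow (hermfun f B) (1 - alpha)
                *m hermpow (hermfun f A) (alpha / 2) *m U in
       [/\ U \is unitarymx, real_eigenvalues X &
           le_vec (lambda_down X)
                  (lambda_down (hermfun f (alpha%:C *: A + (1 - alpha)%:C *: B)))]).
Proof.
pose g x := ln (f x); have g_mono : monotone_on I g by exact: monotone_on_ln.
have [Ua [a [Uau AE _]]] := herm_sorted id A_herm.
have [Ub [b [Ubu BE _]]] := herm_sorted id B_herm.
have aI : forall i, a 0 i \in I.
  by apply: (spectrum_udiag Uau); rewrite -AE; exact: A_spec.
have bI : forall i, b 0 i \in I.
  by apply: (spectrum_udiag Ubu); rewrite -BE; exact: B_spec.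
(* Sorting by [f] makes [map_mx f h] decreasing whichever way [f] is monotone, so it is the desired
   [lambda_down]. *)
have [U [h [Uu HE dh]]] := herm_sorted f (herm_combination alpha (1 - alpha) A_herm B_herm).
have Kh : alpha%:C *: udiag Ua (map_mx g a) + (1 - alpha)%:C *: udiag Ub (map_mx g b)
    \is hermsymmx.
  by apply: herm_combination; apply/is_hermitianmxP; rewrite scale1r udiag_herm.
have [V [k [Vu KE dk]]] := herm_sorted id Kh.
have {}dk : nonincr k by move=> i j /dk; rewrite !mxE.
have KE' : udiag Ua (alpha *: map_mx g a) + udiag Ub ((1 - alpha) *: map_mx g b) = udiag V k.
  by rewrite -!udiagZ.
have [W Wu charW] := trotter_unitary Uau Ubu Vu dk KE'.
have de : nonincr (map_mx expR k) by move=> i j ij; rewrite !mxE ler_expR dk.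
have HAE : hermpow (hermfun f A) (alpha / 2) = udiag Ua (texp (1 / 2) (alpha *: map_mx g a)).
  by rewrite AE; apply: (hermpow_hermfun f_gt0 Uau aI); field.
have HBE : hermpow (hermfun f B) (1 - alpha) = udiag Ub (texp 1 ((1 - alpha) *: map_mx g b)).
  by rewrite BE; apply: (hermpow_hermfun f_gt0 Ubu bI); exact: mul1r.
have XW (M N : 'M[R[i]]_n) : M = udiag Ua (texp (1 / 2) (alpha *: map_mx g a)) ->
    N = udiag Ub (texp 1 ((1 - alpha) *: map_mx g b)) ->
    real_eigenvalues (M *m N *m M *m W) /\ lambda_down (M *m N *m M *m W) = map_mx expR k.
  by move=> -> ->; exact: lambda_downE de charW.
have {XW} [Xreal XE] := XW _ _ HAE HBE.
have HfE (M : 'M[R[i]]_n) : M = udiag U h -> lambda_down (hermfun f M) = map_mx f h.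
  by move=> ->; rewrite (hermfunE f h Uu); exact: (lambda_down_udiag Uu dh).
have {HfE} fHE := HfE _ HE.
have {AE BE}HE : alpha%:C *: udiag Ua a + (1 - alpha)%:C *: udiag Ub b = udiag U h.
  by rewrite -AE -BE.
have dgh : (forall i, h 0 i \in I) -> nonincr (map_mx g h).
  move=> hI i j ij; rewrite !mxE ler_ln ?posrE ?f_gt0 ?hI //.
  by have := dh i j ij; rewrite !mxE.
split=> fI; exists W; split; try exact: Wu; try exact: Xreal.
  have hI := combination_eig_mem fI alpha01 Uau Ubu aI bI Uu HE.
  rewrite XE fHE => j; rewrite !mxE.
  have := convex_eig_le fI g_mono alpha01 Uau Ubu aI bI Uu Vu HE KE
    (or_introl (conj (dgh hI) dk)) j.
  by rewrite -{2}[f _]lnK ?posrE ?f_gt0 ?ler_expR.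
have hI := combination_eig_mem fI alpha01 Uau Ubu aI bI Uu HE.
(* In the log-concave case the comparison is applied to the convex [g'], which turns [K] into [-K];
   the sorted lists are now increasing, hence the second alternative of [convex_eig_le]. *)
pose g' x := - ln (f x).
have g'E (d : 'rV[R]_n) : map_mx g' d = - map_mx g d.
  by apply/rowP => i; rewrite !mxE.
have KE2 : alpha%:C *: udiag Ua (map_mx g' a) + (1 - alpha)%:C *: udiag Ub (map_mx g' b)
    = udiag V (- k).
  by rewrite !g'E !udiagN !scalerN -opprD KE.
have sorted' : nonincr (- map_mx g' h) /\ nonincr (- - k).
  by rewrite g'E !opprK; split; [exact: dgh | exact: dk].
rewrite XE fHE => j; rewrite !mxE.
have := convex_eig_le fI (monotone_onN g_mono) alpha01 Uau Ubu aI bI Uu Vu HE KE2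
  (or_intror sorted') j.
rewrite mxE lerN2 => le_kg.
by rewrite -[leRHS]lnK ?posrE ?f_gt0 ?ler_expR.
Qed.
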